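(* Let $k$ be an algebraically closed field of characteristic $p>0$ and let $H$ be a finite-dimensional pointed rank one Hopf algebra over $k$ that is generated as an algebra by $H_1$ and whose coradical $H_0$ is semi-simple (as an algebra). Then $H$ is isomorphic to a Hopf algebra $H_R$ with $r=0$ or to a Hopf algebra $H_F$.
   Context: For a finite-dimensional Hopf algebra $H$ over $k$: $G(H)$ is the group of group-like elements; the coradical $H_0$ is the sum of the simple subcoalgebras; $H_1=\Delta^{-1}(H\otimes H_0+H_0\otimes H)$. $H$ is pointed if all simple subcoalgebras are one-dimensional, so that $H_0=kG(H)$. A pointed $H$ has rank $t$ if $\dim_k k\otimes_{H_0}H_1=t+1$ ($k$ trivial via the counit). First type $H_R$. Let $R=(G,\chi,a,\alpha)$ where $G$ is a finite group, $a\in Z(G)$, $\chi:G\to k^*$ a linear character with $\chi(a)\ne 1$, $\alpha=(\alpha_{-1},\alpha_0,\dots,\alpha_{r-1})\in k^{r+1}$, $r\ge 0$. Let $N$ be the order of $\chi(a)$ and $n=p^rN$. It is assumed that $\alpha_{-1}=0$ if $a^n=1$; that if $\alpha_i\ne0$ for some $i\ge0$ then $a^{N(p^r-p^i)}=1$ and $\chi(g)^{N(p^r-p^i)}=1$ for all $g\in G$; and that if $\alpha_{-1}\neq0$ then $\chi(g)^{Np^r}=1$ for all $g\in G$. $H_R$ is the algebra containing $kG$ and an element $x$, with basis $(gx^i)_{g\in G,\,0\le i\le n-1}$ and relations $gxg^{-1}=\chi(g)x$ ($g\in G$), $x^n=\alpha_{-1}(a^n-1)+\sum_{i=0}^{r-1}\alpha_ix^{p^iN}$;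 its Hopf structure is $\Delta(gx^i)=(g\otimes g)(x\otimes a+1\otimes x)^i$, $\epsilon(gx^i)=\delta_{i,0}$, $S(gx^i)=(-xa^{-1})^ig^{-1}$. Second type $H_F$. Let $F=(G,\chi,c,a,(\alpha_{-1},\alpha_0))$ where $G$ is a finite group, $a\in Z(G)$, $\chi:G\to k^*$ a linear character with $\chi(a)=1$, $c:G\to k$ a map with $c(hg)=\chi(g)c(h)+c(g)$ for all $g,h\in G$ and $c(a)=0$, and $\alpha_{-1},\alpha_0\in k$ with $\alpha_0\in\{0,1\}$ and $\alpha_{-1}=0$ if $\alpha_0=0$. It is assumed that if $\alpha_0=0$ then $c(g)(a^p-1)=0$ in $kG$ for all $g\in G$; and if $\alpha_0=1$ then $a^p=a$, and for all $g\in G$ one has $\chi(g)\in\mathbb{F}_p^*$ and $(\alpha_{-1}(\chi(g)-1)+c(g)^p-c(g))(a-1)=0$ in $kG$. $H_F$ is the algebra containing $kG$ and an element $x$, with basis $\{gx^i: g\in G,0\le i\le p-1\}$ and relations $x^p=\alpha_{-1}(a^p-1)+\alpha_0x$, $gxg^{-1}=\chi(g)x+c(g)(a-1)$ ($g\in G$); its Hopf structure is $\Delta(gx^i)=(g\otimes g)(x\otimes a+1\otimes x)^i$, $\epsilon(gx^i)=\delta_{i,0}$, $S(gx^i)=(-xa^{-1})^ig^{-1}$. *)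

(* Defs.v *)
From HB Require Import structures.
From mathcomp Require Import all_boot all_order all_fingroup all_algebra all_solvable all_field.
From mathcomp Require Import boolp zify.

Set Implicit Arguments.
Unset Strict Implicit.
Unset Printing Implicit Defensive.

Import GRing.Theory VectorInternalTheory.
Local Open Scope ring_scope.

(* The tensor product of two finite-dimensional vector spaces is modelled by
   matrices: [tens u v] is the outer product of the coordinate vectors of u and
   v.  The universal property is given by [tlift], [tlift_tens] and [tens_ind].
   It is a separate constant because its algebra structure, defined below, is
   not the one of square matrices. *)
Definition tensor (k : fieldType) (U V : vectType k) : Type :=
  'M[k]_(dim U, dim V).

HB.instance Definition _ (k : fieldType) (U V : vectType k) :=
  Vector.copy (tensor U V) 'M[k]_(dim U, dim V).

Section TensorVect.
Variable k : fieldType.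
Implicit Types U V W : vectType k.

Definition tens U V (u : U) (v : V) : tensor U V := (v2r u)^T *m v2r v.

(* The linear map induced by a bilinear map b. *)
Definition tlift U V W (b : U -> V -> W) (t : tensor U V) : W :=
  \sum_i \sum_j (t : 'M[k]_(dim U, dim V)) i j *:
     b (r2v (delta_mx 0 i)) (r2v (delta_mx 0 j)).

Lemma tensDl U V (u1 u2 : U) (v : V) :
  tens (u1 + u2) v = tens u1 v + tens u2 v.
Proof. by rewrite /tens linearD linearD /= mulmxDl. Qed.

Lemma tensDr U V (u : U) (v1 v2 : V) :
  tens u (v1 + v2) = tens u v1 + tens u v2.
Proof. by rewrite /tens linearD /= mulmxDr. Qed.

Lemma tensZl U V a (u : U) (v : V) : tens (a *: u) v = a *: tens u v.
Proof. by rewrite /tens linearZ /= linearZ /= -scalemxAl. Qed.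

Lemma tensZr U V a (u : U) (v : V) : tens u (a *: v) = a *: tens u v.
Proof. by rewrite /tens linearZ /= -scalemxAr. Qed.

Lemma tlift_is_linear U V W (b : U -> V -> W) : linear (tlift b).
Proof.
move=> a s t; rewrite /tlift scaler_sumr -big_split; apply: eq_bigr => i _ /=.
rewrite scaler_sumr -big_split; apply: eq_bigr => j _ /=.
by rewrite !mxE scalerDl scalerA.
Qed.

HB.instance Definition _ U V W (b : U -> V -> W) :=
  GRing.isLinear.Build k (tensor U V) W _ (tlift b) (tlift_is_linear b).

Lemma tliftD U V W (b : U -> V -> W) s t :
  tlift b (s + t) = tlift b s + tlift b t.
Proof. exact: linearD. Qed.

Lemma tliftZ U V W (b : U -> V -> W) a t : tlift b (a *: t) = a *: tlift b t.
Proof. exact: linearZ. Qed.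

Lemma r2v_sum V (v : V) :
  v = \sum_j (v2r v) 0 j *: r2v (delta_mx 0 j).
Proof.
rewrite -[LHS]v2rK {1}[v2r v]row_sum_delta linear_sum.
by apply: eq_bigr => j _; rewrite linearZ.
Qed.

Lemma tlift_tens U V W (b : U -> V -> W)
    (bl : forall v, linear (b^~ v)) (br : forall u, linear (b u)) u v :
  tlift b (tens u v) = b u v.
Proof.
pose bl' x : {linear U -> W} :=
  HB.pack (b^~ x) (GRing.isLinear.Build k U W _ (b^~ x) (bl x)).
pose br' x : {linear V -> W} :=
  HB.pack (b x) (GRing.isLinear.Build k V W _ (b x) (br x)).
rewrite [in RHS](r2v_sum u) -[RHS]/(bl' _ _) linear_sum; apply: eq_bigr => i _.
rewrite linearZ /= {2}(r2v_sum v) -/(br' _ _) -[b _ _]/(br' _ _) linear_sum.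
rewrite scaler_sumr; apply: eq_bigr => j _.
by rewrite linearZ /= scalerA /tens mxE big_ord1 mxE.
Qed.

Lemma tens_ind U V (P : tensor U V -> Prop) :
  (forall u v, P (tens u v)) -> (forall s t, P s -> P t -> P (s + t)) ->
  forall t, P t.
Proof.
move=> Pt PD t.
have P0 : P 0 by rewrite -[0](scale0r (tens 0 0)) -tensZl; apply: Pt.
rewrite [t]matrix_sum_delta; apply: (big_ind P) => // i _.
apply: (big_ind P) => // j _; rewrite -[delta_mx _ _]/(_ : tensor U V).
have -> : delta_mx i j = tens (r2v (delta_mx 0 i)) (r2v (delta_mx 0 j)).
  by rewrite /tens !r2vK trmx_delta mul_delta_mx.
by rewrite -[_ *: _]tensZl; apply: Pt.
Qed.

Definition tmap U V U' V' (f : U -> U') (g : V -> V') :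
  tensor U V -> tensor U' V' := tlift (fun u v => tens (f u) (g v)).

Definition tassoc U V W : tensor (tensor U V) W -> tensor U (tensor V W) :=
  tlift (fun s w => tlift (fun u v => tens u (tens v w)) s).

Definition tensv U V (A : {vspace U}) (B : {vspace V}) : {vspace tensor U V} :=
  <<[seq tens u v | u <- vbasis A, v <- vbasis B]>>%VS.

End TensorVect.

Section TensorAlg.
Variables (k : fieldType) (A B : falgType k).
Implicit Types r s t : tensor A B.

Definition tmul s t : tensor A B :=
  tlift (fun a b => tlift (fun c d => tens (a * c) (b * d)) t) s.

Lemma tmulDl : left_distributive tmul +%R.
Proof. by move=> r s t; rewrite /tmul linearD. Qed.

Lemma tmulZl x s t : tmul (x *: s) t = x *: tmul s t.
Proof. by rewrite /tmul linearZ. Qed.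

Lemma tmulDr : right_distributive tmul +%R.
Proof.
move=> r s t; rewrite /tmul ![tlift _ r]/tlift -big_split; apply: eq_bigr => i _ /=.
rewrite -big_split; apply: eq_bigr => j _ /=.
by rewrite tliftD scalerDr.
Qed.

Lemma tmulZr x s t : tmul s (x *: t) = x *: tmul s t.
Proof.
rewrite /tmul ![tlift _ s]/tlift scaler_sumr; apply: eq_bigr => i _ /=.
rewrite scaler_sumr; apply: eq_bigr => j _ /=.
by rewrite tliftZ !scalerA mulrC.
Qed.

Lemma tmul_tens (a c : A) (b d : B) :
  tmul (tens a b) (tens c d) = tens (a * c) (b * d).
Proof.
have inner a' b' t : tmul (tens a' b') t =
    tlift (fun c d => tens (a' * c) (b' * d)) t.
  elim/tens_ind: t => [c' d'|s t IHs IHt]; last by rewrite tmulDr IHs IHt linearD.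
  rewrite /tmul tlift_tens // => w x y z.
    rewrite /tlift scaler_sumr -big_split; apply: eq_bigr => i _ /=.
    rewrite scaler_sumr -big_split; apply: eq_bigr => j _ /=.
    by rewrite mulrDl -scalerAl tensDl tensZl scalerDr !scalerA mulrC.
  rewrite /tlift scaler_sumr -big_split; apply: eq_bigr => i _ /=.
  rewrite scaler_sumr -big_split; apply: eq_bigr => j _ /=.
  by rewrite mulrDl -scalerAl tensDr tensZr scalerDr !scalerA mulrC.
rewrite inner tlift_tens // => [v|u] x y z.
  by rewrite mulrDr tensDl -scalerAr tensZl.
by rewrite mulrDr tensDr -scalerAr tensZr.
Qed.

Lemma tmulA : associative tmul.
Proof.
move=> r s t; elim/tens_ind: r => [a b|? ? I J]; last by rewrite !tmulDl I J.
elim/tens_ind: s => [c d|? ? I J]; last by rewrite tmulDl !tmulDr tmulDl I J.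
elim/tens_ind: t => [e f|? ? I J]; last by rewrite !tmulDr I J.
by rewrite !tmul_tens !mulrA.
Qed.

Lemma tmul1l : left_id (tens 1 1) tmul.
Proof.
elim/tens_ind => [a b|? ? I J]; last by rewrite tmulDr I J.
by rewrite tmul_tens !mul1r.
Qed.

Lemma tmul1r : right_id (tens 1 1) tmul.
Proof.
elim/tens_ind => [a b|? ? I J]; last by rewrite tmulDl I J.
by rewrite tmul_tens !mulr1.
Qed.

Lemma tens1_neq0 : tens (1 : A) (1 : B) != 0.
Proof.
have nz (C : falgType k) : exists i, v2r (1 : C) 0 i != 0.
  apply/existsP; apply: contraT; rewrite negb_exists => /forallP h.
  suff: (1 : C) == 0 by rewrite oner_eq0.
  apply/eqP/v2r_inj; rewrite linear0; apply/rowP => i.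
  by rewrite mxE; apply/eqP; move: (h i); rewrite negbK.
have [i hi] := nz A; have [j hj] := nz B.
apply/eqP => /matrixP /(_ i j); rewrite !mxE big_ord1 mxE => /eqP.
by rewrite mulf_eq0 (negPf hi) (negPf hj).
Qed.

HB.instance Definition _ := GRing.Zmodule_isNzRing.Build (tensor A B)
  tmulA tmul1l tmul1r tmulDl tmulDr tens1_neq0.
HB.instance Definition _ := GRing.Lmodule_isLalgebra.Build k (tensor A B)
  (fun x s t => esym (tmulZl x s t)).
HB.instance Definition _ := GRing.Lalgebra_isAlgebra.Build k (tensor A B)
  (fun x s t => esym (tmulZr x s t)).
HB.instance Definition _ := Algebra_isFalgebra.Build k (tensor A B).

End TensorAlg.

Record hopfAlgType (k : fieldType) := HopfAlg {
  hopf_alg :> falgType k;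
  comul : 'AHom(hopf_alg, tensor hopf_alg hopf_alg);
  counit : 'AHom(hopf_alg, k^o);
  antipode : 'End(hopf_alg);
  comulA : forall h : hopf_alg,
    tassoc (tmap comul id (comul h)) = tmap id comul (comul h);
  comul1l : forall h : hopf_alg,
    tlift (fun u v => counit u *: v) (comul h) = h;
  comul1r : forall h : hopf_alg,
    tlift (fun u v => counit v *: u) (comul h) = h;
  antipodel : forall h : hopf_alg,
    tlift (fun u v => antipode u * v) (comul h) = (counit h)%:A;
  antipoder : forall h : hopf_alg,
    tlift (fun u v => u * antipode v) (comul h) = (counit h)%:A
}.

Arguments comul {k _}.
Arguments counit {k _}.
Arguments antipode {k _}.

(* The span of an arbitrary (possibly infinite) set of vectors. *)
Section SpanOf.
Variables (k : fieldType) (V : vectType k).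

Lemma spanof_ex (X : V -> Prop) : exists U : {vspace V},
  (forall v, X v -> v \in U) /\
  (forall W : {vspace V}, (forall v, X v -> v \in W) -> (U <= W)%VS).
Proof.
suff main n (U : {vspace V}) : (\dim {:V} - \dim U < n)%N ->
    (forall W : {vspace V}, (forall v, X v -> v \in W) -> (U <= W)%VS) ->
    exists U' : {vspace V}, (forall v, X v -> v \in U') /\
    (forall W : {vspace V}, (forall v, X v -> v \in W) -> (U' <= W)%VS).
  by apply: (main _ 0%VS (ltnSn _)) => W _; rewrite sub0v.
elim: n U => // n IHn U ltn minU.
have [sXU|/existsNP[v /not_implyP[Xv /negP vU]]] := EM (forall v, X v -> v \in U).
  by exists U.
apply: (IHn (U + <[v]>)%VS) => [|W sXW]; last first.
  by rewrite subv_add minU // -memvE sXW.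
have lt1 : (\dim U < \dim (U + <[v]>))%N.
  rewrite ltnNge; apply: contra vU => le; rewrite memvE.
  have /eqP -> : (U == U + <[v]>)%VS by rewrite eqEdim addvSl le.
  exact: addvSr.
have := dimvS (subvf (U + <[v]>)); lia.
Qed.

Definition spanof (X : V -> Prop) : {vspace V} := sval (cid (spanof_ex X)).
End SpanOf.

Section Coalgebra.
Variables (k : fieldType) (H : hopfAlgType k).
Implicit Types C D : {vspace H}.

Definition subcoalg C : Prop := (comul @: C <= tensv C C)%VS.

Definition simple_subcoalg C : Prop :=
  [/\ subcoalg C, C != 0%VS &
      forall D, subcoalg D -> (D <= C)%VS -> D = 0%VS \/ D = C].

Definition coradical : {vspace H} :=
  spanof (fun v => exists2 C, simple_subcoalg C & v \in C).

Definition coradical1 : {vspace H} :=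
  (comul @^-1: (tensv fullv coradical + tensv coradical fullv))%VS.

Definition pointed : Prop := forall C, simple_subcoalg C -> \dim C = 1%N.

(* The defining relations of k (x)_{H_0} H_1 as a quotient of k (x) H_1, where
   H_0 acts on k through the counit. *)
Definition balancing : {vspace tensor k^o H} :=
  spanof (fun t => exists (c : k^o) (a h : H),
    [/\ a \in coradical, h \in coradical1 &
        t = tens (c * counit a) h - tens c (a * h)]).

(* [U :\: W] is a complement of U :&: W in U, hence a model of U / W. *)
Definition has_rank (t : nat) : Prop :=
  \dim (tensv {: k^o} coradical1 :\: balancing)%VS = t.+1.

End Coalgebra.

Section Semisimple.
Variables (k : fieldType) (A : falgType k).
Implicit Types B I J : {vspace A}.

Definition left_ideal_of B I : Prop := (I <= B)%VS /\ (B * I <= I)%VS.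

Definition simple_left_ideal_of B I : Prop :=
  [/\ left_ideal_of B I, I != 0%VS &
      forall J, left_ideal_of B J -> (J <= I)%VS -> J = 0%VS \/ J = I].

(* Meant for subalgebras B, such as the coradical kG(H) of a pointed H: the
   regular left B-module is a sum of simple submodules. *)
Definition semisimple B : Prop :=
  B = spanof (fun v => exists2 I, simple_left_ideal_of B I & v \in I).

End Semisimple.

Definition hopf_iso (k : fieldType) (H K : hopfAlgType k) : Prop :=
  exists f : 'AHom(H, K),
    [/\ bijective f,
        forall h, comul (f h) = tmap f f (comul h),
        forall h, counit (f h) = counit h &
        forall h, antipode (f h) = f (antipode h)].

(* Only the vector space structure of kG is needed: its elements are functions
   on G, and [grpelt g] is the basis vector g. *)
Definition grpalg (k : fieldType) (G : finGroupType) := {ffun G -> k^o}.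
Definition grpelt (k : fieldType) (G : finGroupType) (g : G) : grpalg k G :=
  [ffun h => (h == g)%:R].

Section Data.
Variables (k : fieldType) (p : nat).

(* dR_alpham1 is alpha_{-1}; dR_N is determined by dR_NP as the order of
   chi(a). *)
Record datumR := DatumR {
  dR_G : finGroupType;
  dR_chi : dR_G -> k;
  dR_a : dR_G;
  dR_r : nat;
  dR_alpham1 : k;
  dR_alpha : 'I_dR_r -> k;
  dR_N : nat;
  dR_chi1 : dR_chi 1%g = 1;
  dR_chiM : forall g h, dR_chi (g * h)%g = dR_chi g * dR_chi h;
  dR_aZ : dR_a \in 'Z([set: dR_G])%g;
  dR_chia : dR_chi dR_a != 1;
  dR_NP : dR_N.-primitive_root (dR_chi dR_a);
  dR_n := (p ^ dR_r * dR_N)%N;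
  dR_am1 : (dR_a ^+ dR_n = 1)%g -> dR_alpham1 = 0;
  dR_alphaP : forall i : 'I_dR_r, dR_alpha i != 0 ->
    (dR_a ^+ (dR_N * (p ^ dR_r - p ^ i)) = 1)%g /\
    (forall g, dR_chi g ^+ (dR_N * (p ^ dR_r - p ^ i)) = 1);
  dR_alpham1P : dR_alpham1 != 0 ->
    forall g, dR_chi g ^+ (dR_N * p ^ dR_r) = 1
}.

Record datumF := DatumF {
  dF_G : finGroupType;
  dF_chi : dF_G -> k;
  dF_c : dF_G -> k;
  dF_a : dF_G;
  dF_alpham1 : k;
  dF_alpha0 : k;
  dF_chi1 : dF_chi 1%g = 1;
  dF_chiM : forall g h, dF_chi (g * h)%g = dF_chi g * dF_chi h;
  dF_aZ : dF_a \in 'Z([set: dF_G])%g;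
  dF_chia : dF_chi dF_a = 1;
  dF_cM : forall g h, dF_c (h * g)%g = dF_chi g * dF_c h + dF_c g;
  dF_ca : dF_c dF_a = 0;
  dF_alpha0P : dF_alpha0 = 0 \/ dF_alpha0 = 1;
  dF_alpham10 : dF_alpha0 = 0 -> dF_alpham1 = 0;
  dF_alpha00 : dF_alpha0 = 0 -> forall g,
    dF_c g *: (grpelt k (dF_a ^+ p)%g - grpelt k 1%g) = 0;
  dF_alpha01 : dF_alpha0 = 1 -> (dF_a ^+ p = dF_a)%g /\ forall g,
    (exists2 u : 'F_p, u != 0 & dF_chi g = (u : nat)%:R) /\
    (dF_alpham1 * (dF_chi g - 1) + dF_c g ^+ p - dF_c g)
      *: (grpelt k dF_a - grpelt k 1%g) = 0
}.

(* H_R and H_F are determined up to isomorphism by their bases, relations and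
   structure maps, so they are specified by predicates rather than constructed.
   What they share: K contains kG (through i) and x, the g x^j with
   j < n form a basis, and these have the prescribed images under the structure
   maps. *)
Definition hopf_on (G : finGroupType) (a : G) (n : nat) (K : hopfAlgType k)
    (i : G -> K) (x : K) : Prop :=
  [/\ i 1%g = 1 /\ (forall g h, i (g * h)%g = i g * i h),
      basis_of {: K} [seq i g * x ^+ j | g <- enum G, j <- iota 0 n],
      forall g j, (j < n)%N -> comul (i g * x ^+ j) =
        tens (i g) (i g) * (tens x (i a) + tens 1 x) ^+ j,
      forall g j, (j < n)%N -> counit (i g * x ^+ j) = (j == 0)%:R &
      forall g j, (j < n)%N -> antipode (i g * x ^+ j) =
        (- (x * i a^-1%g)) ^+ j * i g^-1%g].

Definition is_HR (R : datumR) (K : hopfAlgType k) : Prop :=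
  exists (i : dR_G R -> K) (x : K),
  [/\ hopf_on (dR_a R) (dR_n R) i x,
      forall g, i g * x * i g^-1%g = dR_chi g *: x &
      x ^+ dR_n R = dR_alpham1 R *: (i (dR_a R ^+ dR_n R)%g - 1)
        + \sum_(j < dR_r R) dR_alpha j *: x ^+ (p ^ j * dR_N R)].

Definition is_HF (F : datumF) (K : hopfAlgType k) : Prop :=
  exists (i : dF_G F -> K) (x : K),
  [/\ hopf_on (dF_a F) p i x,
      forall g, i g * x * i g^-1%g
        = dF_chi g *: x + dF_c g *: (i (dF_a F) - 1) &
      x ^+ p = dF_alpham1 F *: (i (dF_a F ^+ p)%g - 1) + dF_alpha0 F *: x].

End Data.

(* Main.v *)
Require Import Defs.
From HB Require Import structures.
From mathcomp Require Import all_boot all_order all_fingroup all_algebra all_solvable all_field.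
From mathcomp Require Import boolp zify ring.

Set Implicit Arguments.
Unset Strict Implicit.
Unset Printing Implicit Defensive.

Import GRing.Theory VectorInternalTheory.
Local Open Scope ring_scope.

(** A pointed Hopf algebra H of rank one has essentially one nontrivial
    skew-primitive element x, and the theorem records how x interacts with the
    group G of group-like elements and with its own powers.

    By the Taft-Wilson decomposition [Taft_Wilson], H_1 is kG plus the spaces of
    (g,h)-skew-primitive elements; after translation by g, only elements x with
    Delta(x) = x (x) b + 1 (x) x matter.  A left coinvariant map [coinv] shows
    that the quotient of k (x) H_1 that defines the rank is k plus the space of
    classes modulo kG of these x.  Rank one therefore says that the classes form
    a single line: there is x, attached to one group-like a, outside kG
    ([exists_skewprim]), and every other such element is a multiple of x modulo kG
    ([skewprim_unique], [skewprim_classify]).  Conjugating x by g gives another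
    one, so a is central and g x g^-1 = chi(g) x + c(g)(a - 1); uniqueness of the
    coefficients makes chi a character and c a cocycle ([conj_chicM]).

    Let q = chi(a), suppose a x = q x a, and let n be least with
    1 + q + ... + q^(n-1) = 0: the order of q if q <> 1, and p if q = 1.  The
    quantum binomial theorem gives Delta(x^n) = x^n (x) a^n + 1 (x) x^n
    ([skewprim_qchar]), so x^n is again a combination of x and a^n - 1.  Below
    degree n the quantum integers are nonzero and the elements g x^j are linearly
    independent ([powers_free]); they span because H_1 generates H
    ([powspan_full]).  So H is its own model, and only the relations have to be
    normalised.

    If q <> 1, a translation of x by a multiple of a - 1 makes c(a) vanish, and
    then c = 0 because a is central.  Conjugation by a multiplies x by q but
    fixes x^n, so x^n is a multiple of a^n - 1: this is H_R with r = 0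
    ([rank_one_R]).

    If q = 1, then c is additive on the powers of a, so |G| c(a) = 0, and
    semisimplicity of kG makes |G| invertible in k ([semisimple_card]); thus x
    commutes with a.  Either x^p is a multiple of a^p - 1 and a translation of x
    makes x^p = 0, or a^p = a and a rescaling makes x^p = x + alpha(a - 1).
    Conjugating the relation for x^p by g gives the conditions on chi and c that
    define H_F ([rank_one_F_normal], [rank_one_F]). *)

(** * Linear algebra of tensor products *)

Section Tensors.
Variable k : fieldType.
Implicit Types U V W : vectType k.

HB.instance Definition _ U V U' V' (f : U -> U') (g : V -> V') :=
  GRing.Linear.copy (tmap f g) (tlift (fun u v => tens (f u) (g v))).
HB.instance Definition _ U V W :=
  GRing.Linear.copy (@tassoc k U V W)
    (tlift (fun s w => tlift (fun u v => tens u (tens v w)) s)).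

Lemma tens_linearr U V (u : U) : linear (fun v : V => tens u v).
Proof. by move=> a x y; rewrite tensDr tensZr. Qed.

HB.instance Definition _ U V (u : U) :=
  GRing.isLinear.Build k V (tensor U V) _ (tens u) (tens_linearr u).

Lemma tens_suml U V I (r : seq I) (P : pred I) (F : I -> U) (v : V) :
  tens (\sum_(i <- r | P i) F i) v = \sum_(i <- r | P i) tens (F i) v.
Proof.
elim/big_rec2: _ => [|i x y _ <-]; last by rewrite tensDl.
by rewrite -(scale0r (0 : U)) tensZl scale0r.
Qed.

Lemma tens0l U V (v : V) : tens (0 : U) v = 0.
Proof. by rewrite -(scale0r (0 : U)) tensZl scale0r. Qed.

Lemma tensBl U V (u1 u2 : U) (v : V) : tens (u1 - u2) v = tens u1 v - tens u2 v.
Proof. by rewrite -scaleN1r tensDl tensZl scaleN1r. Qed.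

Lemma tmap_tens U V U' V' (f : U -> U') (g : V -> V') u v :
  linear f -> linear g -> tmap f g (tens u v) = tens (f u) (g v).
Proof.
by move=> lf lg; rewrite /tmap tlift_tens // => [w|w] a x y;
  rewrite (lf, lg) (tensDl, tensDr) (tensZl, tensZr).
Qed.

Lemma tmap_id U V (t : tensor U V) : tmap id id t = t.
Proof.
by elim/tens_ind: t => [u v|s t IHs IHt]; rewrite ?tmap_tens // linearD /= IHs IHt.
Qed.

Lemma tassoc_tens U V W (s : tensor U V) (w : W) :
  tassoc (tens s w) = tlift (fun u v => tens u (tens v w)) s.
Proof.
rewrite /tassoc tlift_tens // => [v|u] a x y; first by rewrite linearP.
elim/tens_ind: u => [u v|s' t IHs IHt].
  by rewrite !tlift_tens;
  try move=> ? ? ? ?; rewrite ?(tensDl, tensDr, tensZl, tensZr).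
by rewrite !linearD /= IHs IHt addrACA.
Qed.

Lemma tassoc_tens3 U V W (u : U) (v : V) (w : W) :
  tassoc (tens (tens u v) w) = tens u (tens v w).
Proof.
by rewrite tassoc_tens tlift_tens;
  try move=> ? ? ? ?; rewrite ?(tensDl, tensDr, tensZl, tensZr).
Qed.

(** Contracting one leg of a tensor with a functional turns statements about
    coproducts into statements about elements and operators of H. *)
Definition lcontr U V (f : 'Hom(U, k^o)) : tensor U V -> V :=
  tlift (fun u v => (f u : k) *: v).
Definition rcontr U V (f : 'Hom(V, k^o)) : tensor U V -> U :=
  tlift (fun u v => (f v : k) *: u).

HB.instance Definition _ U V f := GRing.Linear.copy (@lcontr U V f) (tlift _).
HB.instance Definition _ U V f := GRing.Linear.copy (@rcontr U V f) (tlift _).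

Lemma lcontr_tens U V (f : 'Hom(U, k^o)) u (v : V) :
  lcontr f (tens u v) = (f u : k) *: v.
Proof.
rewrite /lcontr tlift_tens // => [w|w] a x y; first by rewrite linearP scalerDl scalerA.
by rewrite scalerDr !scalerA mulrC.
Qed.

Lemma rcontr_tens U V (f : 'Hom(V, k^o)) (u : U) v :
  rcontr f (tens u v) = (f v : k) *: u.
Proof.
rewrite /rcontr tlift_tens // => [w|w] a x y; last by rewrite linearP scalerDl scalerA.
by rewrite scalerDr !scalerA mulrC.
Qed.

Lemma lcontr_tassoc U V W (f : 'Hom(U, k^o)) (s : tensor U V) (w : W) :
  lcontr f (tassoc (tens s w)) = tens (lcontr f s) w.
Proof.
elim/tens_ind: s => [u v|s t IHs IHt].
  by rewrite tassoc_tens3 !lcontr_tens tensZl.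
by rewrite tensDl !linearD /= IHs IHt tensDl.
Qed.

Lemma rcontr_tassoc U V W (f : 'Hom(W, k^o)) (s : tensor U V) (w : W) :
  tmap id (rcontr f) (tassoc (tens s w)) = (f w : k) *: s.
Proof.
elim/tens_ind: s => [u v|s t IHs IHt].
  by rewrite tassoc_tens3 tmap_tens ?rcontr_tens ?tensZr //; apply: linearP.
by rewrite tensDl !linearD /= IHs IHt.
Qed.

Lemma tensv_ind U V (A : {vspace U}) (B : {vspace V}) (W : {vspace tensor U V}) :
  (forall u v, u \in A -> v \in B -> tens u v \in W) -> (tensv A B <= W)%VS.
Proof.
move=> h; apply/span_subvP => _ /allpairsP[[u v] [/= uA vB ->]].
by apply: h; apply: vbasis_mem.
Qed.

Lemma memv_tens U V (A : {vspace U}) (B : {vspace V}) u v :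
  u \in A -> v \in B -> tens u v \in tensv A B.
Proof.
move=> uA vB; rewrite (coord_vbasis uA) (coord_vbasis vB) tens_suml.
apply: memv_suml => i _; rewrite linear_sum; apply: memv_suml => j _ /=.
rewrite tensZl tensZr !memvZ // memv_span //.
by apply: allpairs_f; apply: mem_nth; rewrite size_tuple.
Qed.

(** The functional is a coordinate, nonzero at v, of the component along a
    complement of U. *)
Lemma separating_functional V (U : {vspace V}) v : v \notin U ->
  exists f : 'Hom(V, k^o), {in U, forall u, f u = 0} /\ f v = 1.
Proof.
move=> vU; pose w := v - projv U v.
have w0 : w != 0.
  by apply: contra vU; rewrite subr_eq0 => /eqP ->; apply: memv_proj.
have [j wj] : exists j, v2r w 0 j != 0.
  apply/existsP; apply: contraT; rewrite negb_exists => /forallP h.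
  rewrite -(v2rK w) (_ : v2r w = 0) ?linear0 ?eqxx // in w0.
  by apply/rowP => j; rewrite mxE; apply/eqP; move: (h j); rewrite negbK.
pose F (u : V) : k^o := (v2r w 0 j)^-1 * v2r (u - projv U u) 0 j.
have FL : linear F.
  move=> a x y; rewrite /F linearP opprD addrACA -scalerBr linearP /= !mxE.
  by rewrite mulrDr; congr (_ + _); rewrite mulrCA.
pose F' : {linear V -> k^o} := HB.pack F (GRing.isLinear.Build k V k^o _ F FL).
exists (linfun F'); split=> [u uU|]; rewrite lfunE /= /F.
  by rewrite projv_id // subrr linear0 mxE mulr0.
by rewrite mulVf.
Qed.

Lemma dual_family V (I : finType) (b : I -> V) : free [seq b i | i <- enum I] ->
  exists e : I -> 'Hom(V, k^o), forall i j, e i (b j) = (i == j)%:R.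
Proof.
move=> frb.
suff h i : exists f : 'Hom(V, k^o), forall j, f (b j) = (i == j)%:R.
  exact: fin_all_exists h.
have pe : perm_eq (enum I) (i :: rem i (enum I)) by apply: perm_to_rem; rewrite mem_enum.
move: frb; rewrite (perm_free (perm_map b pe)) /= free_cons => /andP[bi _].
have [f [f0 f1]] := separating_functional bi; exists f => j.
have [<-//|ne] := eqVneq i j; apply: f0; apply: memv_span.
by apply: map_f; rewrite mem_rem_uniq ?enum_uniq // !inE eq_sym ne mem_enum.
Qed.

(** Freeness of a doubly indexed family such as the g x^j is easier to check with
    coefficients indexed by I than by positions in the sequence. *)
Lemma freeP_family V (I : eqType) (r : seq I) (b : I -> V) : uniq r ->
  (forall c : I -> k, \sum_(i <- r) c i *: b i = 0 -> {in r, forall i, c i = 0}) ->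
  free (map b r).
Proof.
case: r => [_ _|i0 r']; first exact: nil_free.
set r := i0 :: r' => ur h; rewrite -[map b r]/(tval (map_tuple b (in_tuple r))).
apply/freeP => c hc j.
pose c' i : k := oapp c 0 (insub (index i r)).
have c'E (l : 'I_(size r)) : c' (nth i0 r l) = c l.
  by rewrite /c' index_uniq // valK.
rewrite -c'E; apply: h; last exact: mem_nth.
rewrite (big_nth i0) big_mkord -[RHS]hc; apply: eq_bigr => l _.
by rewrite c'E (nth_map i0).
Qed.
End Tensors.

(** * Functionals acting on H, and the antipode *)

Section HopfBasics.
Variables (k : fieldType) (H : hopfAlgType k).
Implicit Types (f : 'Hom(H, k^o)) (g h u v w x y : H).

(** The two actions of the dual algebra on H, v |-> f(v_1) v_2 and
    v |-> f(v_2) v_1. *)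
Definition lhit f : 'End(H) := (linfun (lcontr f) \o comul)%VF.
Definition rhit f : 'End(H) := (linfun (rcontr f) \o comul)%VF.

Lemma lhitE f v : lhit f v = lcontr f (comul v).
Proof. by rewrite comp_lfunE lfunE. Qed.

Lemma rhitE f v : rhit f v = rcontr f (comul v).
Proof. by rewrite comp_lfunE lfunE. Qed.

(** This is coassociativity with its first leg contracted by f. *)
Lemma comul_lhit f v : comul (lhit f v) = tmap (lhit f) id (comul v).
Proof.
rewrite lhitE; have := congr1 (lcontr f) (comulA v).
have -> t : lcontr f (tmap id comul t) = comul (lcontr f t) :> tensor H H.
  elim/tens_ind: t => [u w|s t IHs IHt]; last by rewrite !linearD /= IHs IHt.
  by rewrite tmap_tens ?lcontr_tens ?linearZ //; apply: linearP.
move=> <-; elim/tens_ind: (comul v) => [u w|s t IHs IHt].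
  rewrite !tmap_tens ?lcontr_tassoc -?lhitE //; exact: linearP.
by rewrite !linearD /= IHs IHt.
Qed.

Lemma comul_rhit f v : comul (rhit f v) = tmap id (rhit f) (comul v).
Proof.
rewrite rhitE; have := congr1 (tmap id (rcontr f)) (comulA v).
have -> t : tmap id (rcontr f) (tassoc (tmap comul id t)) =
    comul (rcontr f t) :> tensor H H.
  elim/tens_ind: t => [u w|s t IHs IHt]; last by rewrite !linearD /= IHs IHt.
  by rewrite tmap_tens ?rcontr_tassoc ?rcontr_tens ?linearZ //; apply: linearP.
move=> ->; elim/tens_ind: (comul v) => [u w|s t IHs IHt].
  by rewrite !tmap_tens -?rhitE //; apply: linearP.
by rewrite !linearD /= IHs IHt.
Qed.

Lemma lhit_counit v : lhit counit v = v.
Proof. by rewrite lhitE; apply: comul1l. Qed.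

Lemma rhit_counit v : rhit counit v = v.
Proof. by rewrite rhitE; apply: comul1r. Qed.

(** The antipode is a right convolution inverse of the identity, so a solution F of
    F * id = z eps is recovered as F = F * (id * S) = (F * id) * S = z S.  Applied
    to F(u) = S(u y), this computes S on products. *)
Lemma antipode_unique (F : 'End(H)) z :
  (forall u, tlift (fun v w => F v * w) (comul u) = (counit u : k) *: z) ->
  forall u, F u = z * antipode u.
Proof.
move=> Fz u.
(* M3 is u (x) v (x) w |-> F(u) v S(w); it is evaluated on the iterated coproduct
   in its two bracketings. *)
pose M3 := tlift (fun v (s : tensor H H) =>
                   F v * tlift (fun w w' => w * antipode w') s).
have SL w : linear (fun v : H => v * antipode w).
  by move=> a x y; rewrite mulrDl scalerAl.
have SR v : linear (fun w : H => v * antipode w).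
  by move=> a x y; rewrite linearP mulrDr scalerAr.
have M3D s t : M3 (s + t) = M3 s + M3 t by exact: linearD.
have M3_tens v s : M3 (tens v s) =
    F v * tlift (fun w w' => w * antipode w') s.
  rewrite /M3 tlift_tens // => [t|w] a x y; first by rewrite linearP mulrDl scalerAl.
  by rewrite linearP mulrDr scalerAr.
have FL w : linear (fun v : H => F v * w).
  by move=> a x y; rewrite linearP mulrDl scalerAl.
have FR v : linear (fun w : H => F v * w).
  by move=> a x y; rewrite mulrDr scalerAr.
have M3_l : M3 (tassoc (tmap comul id (comul u))) = z * antipode u.
  have -> t : M3 (tassoc (tmap comul id t)) = z * antipode (lcontr counit t).
    elim/tens_ind: t => [v w|s t IHs IHt]; last first.
      by rewrite !linearD /= M3D IHs IHt mulrDr.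
    rewrite tmap_tens //; last exact: linearP.
    have -> s : M3 (tassoc (tens s w)) =
        tlift (fun v w => F v * w) s * antipode w.
      elim/tens_ind: s => [a b|s t IHs IHt].
        by rewrite tassoc_tens3 M3_tens !tlift_tens // mulrA.
      by rewrite tensDl linearD /= M3D IHs IHt linearD mulrDl.
    by rewrite Fz lcontr_tens linearZ /= -scalerAl -scalerAr.
  by rewrite -lhitE lhit_counit.
have M3_r : M3 (tmap id comul (comul u)) = F u.
  have -> t : M3 (tmap id comul t) = F (rcontr counit t).
    elim/tens_ind: t => [v w|s t IHs IHt].
      rewrite tmap_tens //; last exact: linearP.
      by rewrite M3_tens antipoder rcontr_tens linearZ /= -scalerAr mulr1.
    by rewrite linearD /= M3D IHs IHt !linearD.
  by rewrite -rhitE rhit_counit.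
by rewrite -M3_l comulA M3_r.
Qed.

(** * Group-like and skew-primitive elements *)

Definition grouplike : pred H :=
  fun g => (comul g == tens g g) && (counit g == 1).

Lemma comul_grouplike g : grouplike g -> comul g = tens g g.
Proof. by case/andP => /eqP. Qed.

Lemma counit_grouplike g : grouplike g -> counit g = 1.
Proof. by case/andP => _ /eqP. Qed.

Lemma grouplike_neq0 g : grouplike g -> g != 0.
Proof.
move=> gg; apply/eqP => g0; have := counit_grouplike gg.
by rewrite g0 linear0 => /eqP; rewrite eq_sym oner_eq0.
Qed.

Lemma tensM u v u' v' : tens u v * tens u' v' = tens (u * u') (v * v') :> tensor H H.
Proof. exact: tmul_tens. Qed.

Lemma grouplike1 : grouplike 1.
Proof. by rewrite /grouplike !rmorph1 !eqxx. Qed.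

Lemma grouplikeM g h : grouplike g -> grouplike h -> grouplike (g * h).
Proof.
move=> gg gh; rewrite /grouplike !rmorphM /= !counit_grouplike // mulr1 eqxx.
by rewrite !comul_grouplike // tensM eqxx.
Qed.

Lemma antipode_mulg g : grouplike g -> antipode g * g = 1.
Proof.
move=> gg; have := antipodel g; rewrite comul_grouplike // counit_grouplike //.
rewrite tlift_tens ?scale1r // => [v|u] a x y.
  by rewrite linearP mulrDl scalerAl.
by rewrite mulrDr scalerAr.
Qed.

Lemma mulg_antipode g : grouplike g -> g * antipode g = 1.
Proof.
move=> gg; have := antipoder g; rewrite comul_grouplike // counit_grouplike //.
rewrite tlift_tens ?scale1r // => [v|u] a x y; last first.
  by rewrite linearP mulrDr scalerAr.
by rewrite mulrDl scalerAl.
Qed.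

Lemma grouplike_antipode g : grouplike g -> grouplike (antipode g).
Proof.
move=> gg; have Sgg := antipode_mulg gg; have gSg := mulg_antipode gg.
apply/andP; split; apply/eqP.
  rewrite -[LHS]mulr1 -[1 in LHS](_ : tens g g * tens (antipode g) (antipode g) = 1).
    rewrite mulrA -{1}comul_grouplike // -rmorphM Sgg rmorph1.
    by rewrite mul1r.
  by rewrite tensM gSg.
by rewrite -[LHS]mulr1 -{1}(counit_grouplike gg) -rmorphM Sgg rmorph1.
Qed.

Lemma lhit_grouplike f g : grouplike g -> lhit f g = (f g : k) *: g.
Proof. by move=> gg; rewrite lhitE comul_grouplike // lcontr_tens. Qed.

Lemma rhit_grouplike f g : grouplike g -> rhit f g = (f g : k) *: g.
Proof. by move=> gg; rewrite rhitE comul_grouplike // rcontr_tens. Qed.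

(** The operators [lhit f] act on group-likes as commuting diagonal operators:
    g is an eigenvector with eigenvalue f(g).  If g is a combination of s and b in s
    occurs in it, the coordinate function of b sends g to a nonzero multiple of g
    and of b, and the counit forces g = b. *)
Lemma grouplike_free s : uniq s -> all grouplike s -> free s.
Proof.
elim: s => [|g s IH] /= => [_ _|/andP[gs us] /andP[gg gls]]; first exact: nil_free.
have frs := IH us gls; rewrite free_cons frs andbT.
apply: contra gs => g_s.
have [b [bs]] : exists b, b \in s /\ exists f, f g != 0 /\
    forall h, h \in s -> h != b -> f h = 0.
  apply: contrapT => hN.
  suff /eqP : g == 0 by apply/eqP/grouplike_neq0.
  rewrite (coord_span (X := in_tuple s) g_s); apply/eqP/big1 => i _.
  apply/eqP; rewrite scaler_eq0; apply/orP; left; apply: contraT => ci.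
  case: hN; exists s`_i; split; first exact: mem_nth.
  exists (linfun (coord (in_tuple s) i : _ -> k^o)); rewrite lfunE.
  split=> // h /(nthP 0)[j js <-]; rewrite nth_uniq // => ji.
  rewrite lfunE /= (coord_free (Ordinal js) i) //.
  by rewrite -val_eqE /= (negPf ji).
case=> f [fg fs].
have : lhit f g \in <[b]>%VS.
  rewrite (coord_span (X := in_tuple s) g_s) linear_sum memv_suml // => i _.
  have si : s`_i \in s by exact: mem_nth.
  rewrite linearZ /= memvZ // lhit_grouplike ?(allP gls) //.
  have [<-|/fs ->//] := eqVneq s`_i b; first by rewrite memvZ ?memv_line.
  by rewrite scale0r mem0v.
rewrite lhit_grouplike // => fgb.
have := memvZ (f g : k)^-1 fgb; rewrite scalerA mulVf // scale1r.
case/vlineP=> c gcb; have := counit_grouplike gg.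
rewrite gcb linearZ /= counit_grouplike ?(allP gls) // => c1.
have {}c1 : c = 1 by rewrite -[c]mulr1.
by rewrite c1 scale1r.
Qed.

Definition skewprim g h x := comul x = tens x h + tens g x.

Lemma lhit_skewprim f g h x : skewprim g h x -> lhit f x = (f x : k) *: h + (f g : k) *: x.
Proof. by move=> sx; rewrite lhitE sx linearD /= !lcontr_tens. Qed.

(** Apply eps (x) id to the coproduct of x: eps(x) h + x = x. *)
Lemma counit_skewprim g h x : grouplike g -> grouplike h -> skewprim g h x -> counit x = 0.
Proof.
move=> gg gh /(lhit_skewprim counit); rewrite lhit_counit (counit_grouplike gg) scale1r.
move/eqP; rewrite -subr_eq0 opprD addrCA subrr addr0 oppr_eq0 scaler_eq0.
by rewrite (negPf (grouplike_neq0 gh)) orbF => /eqP.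
Qed.

Lemma skewprimMl u g h x : grouplike u -> skewprim g h x -> skewprim (u * g) (u * h) (u * x).
Proof.
by move=> gu sx; rewrite /skewprim rmorphM /= sx comul_grouplike // mulrDr !tensM.
Qed.

Lemma skewprimMr u g h x : grouplike u -> skewprim g h x -> skewprim (g * u) (h * u) (x * u).
Proof.
by move=> gu sx; rewrite /skewprim rmorphM /= sx comul_grouplike // mulrDl !tensM.
Qed.

Lemma skewprim_lin c g h x y : skewprim g h x -> skewprim g h y -> skewprim g h (c *: x + y).
Proof.
move=> sx sy; rewrite /skewprim linearP /= sx sy tensDl tensZl tensDr tensZr.
by rewrite scalerDr addrACA.
Qed.

Lemma skewprim_sub g h : grouplike g -> grouplike h -> skewprim g h (h - g).
Proof.
move=> gg gh; rewrite /skewprim linearB /= !comul_grouplike // tensBl.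
by rewrite [tens g (_ - _)]linearB /= addrA subrK.
Qed.
End HopfBasics.

(** * The group of group-like elements *)

Section SpanOf.
Variables (k : fieldType) (V : vectType k) (X : V -> Prop).

Lemma memv_spanof v : X v -> v \in spanof X.
Proof. by rewrite /spanof; case: cid => U [/= XU _] /XU. Qed.

Lemma spanof_sub (W : {vspace V}) : (forall v, X v -> v \in W) -> (spanof X <= W)%VS.
Proof. by rewrite /spanof; case: cid => U [/= _ minU] /minU. Qed.
End SpanOf.

Section GrouplikeGroup.
Variables (k : fieldType) (H : hopfAlgType k).
Implicit Types (u v w x y : H).

(** A maximal list of distinct group-likes exists because such a list is free, hence
    not longer than the dimension of H. *)
Lemma grouplikes_ex : exists s : seq H, forall g, (g \in s) = grouplike g.
Proof.
suff main n (s : seq H) : (dim H - size s < n)%N -> uniq s -> all (@grouplike k H) s ->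
    exists s : seq H, forall g, (g \in s) = grouplike g.
  exact: (main _ [::] (ltnSn _)).
elim: n s => // n IHn s lt us gls.
have [max_s|/existsNP[g /not_implyP[gg /negP gs]]] :=
    EM (forall g : H, grouplike g -> g \in s).
  exists s => g; apply/idP/idP => [|/max_s//]; exact: (allP gls).
apply: (IHn (g :: s)); rewrite /= ?gs ?gg //.
have /eqP szE : free (g :: s) by apply: grouplike_free; rewrite /= ?gs ?gg.
have := dimvS (subvf <<g :: s>>%VS); rewrite szE dimvf /=.
move: lt; rewrite -!/(dim H); move: (dim H) (size s) => d m; lia.
Qed.

Definition grouplikes : seq H := sval (cid grouplikes_ex).

Lemma mem_grouplikes g : (g \in grouplikes) = grouplike g.
Proof. by rewrite /grouplikes; case: cid. Qed.

Definition glgroup : Type := seq_sub grouplikes.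
HB.instance Definition _ := Finite.copy glgroup (seq_sub grouplikes).

Definition glval (g : glgroup) : H := ssval g.

Lemma glvalP g : grouplike (glval g).
Proof. by rewrite -mem_grouplikes; apply: ssvalP. Qed.

Lemma glval_inj : injective glval.
Proof. exact: val_inj. Qed.

Definition glpack v (gv : grouplike v) : glgroup :=
  SeqSub (eq_ind_r is_true gv (mem_grouplikes v)).

Definition glmul (g h : glgroup) := glpack (grouplikeM (glvalP g) (glvalP h)).
Definition glone := glpack (grouplike1 H).
Definition glinv (g : glgroup) := glpack (grouplike_antipode (glvalP g)).

Lemma glmulA : associative glmul.
Proof. by move=> g h l; apply: glval_inj; apply: mulrA. Qed.
Lemma glmul1 : left_id glone glmul.
Proof. by move=> g; apply: glval_inj; apply: mul1r. Qed.
Lemma glmulV : left_inverse glone glinv glmul.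
Proof. by move=> g; apply: glval_inj; apply: antipode_mulg (glvalP g). Qed.

HB.instance Definition _ := Finite_isGroup.Build glgroup glmulA glmul1 glmulV.

Lemma glval1 : glval 1%g = 1. Proof. by []. Qed.
Lemma glvalM g h : glval (g * h)%g = glval g * glval h. Proof. by []. Qed.
Lemma glvalV g : glval g^-1%g = antipode (glval g). Proof. by []. Qed.
Lemma glvalX g n : glval (g ^+ n)%g = glval g ^+ n.
Proof. by elim: n => // n IHn; rewrite expgS exprS glvalM IHn. Qed.
Lemma glmulVr g : glval g^-1%g * glval g = 1.
Proof. by rewrite -glvalM mulVg. Qed.
Lemma glmulrV g : glval g * glval g^-1%g = 1.
Proof. by rewrite -glvalM mulgV. Qed.

Lemma glval_onto v : grouplike v -> exists g, v = glval g.
Proof. by move=> gv; exists (glpack gv). Qed.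

Definition glspan : {vspace H} := <<[seq glval g | g <- enum (glgroup : predArgType)]>>%VS.

Lemma glval_span g : glval g \in glspan.
Proof. by apply: memv_span; apply: map_f; rewrite mem_enum. Qed.

Lemma glval_free : free [seq glval g | g <- enum (glgroup : predArgType)].
Proof.
apply: grouplike_free; first by rewrite (map_inj_uniq glval_inj) enum_uniq.
by apply/allP => _ /mapP[g _ ->]; apply: glvalP.
Qed.

(** Functionals on H dual to the group-likes; on a complement of kG their values are
    arbitrary. *)
Definition glcoef : glgroup -> 'Hom(H, k^o) := sval (cid (dual_family glval_free)).

Lemma glcoefE g h : glcoef g (glval h) = (g == h)%:R.
Proof. by rewrite /glcoef; case: cid. Qed.

(** A projection of H onto kG and the complementary projection: the latter is a
    concrete model of the quotient H / kG. *)
Definition glproj v : H := \sum_g (glcoef g v : k) *: glval g.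

Lemma glproj_linear : linear glproj.
Proof.
move=> a x y; rewrite /glproj scaler_sumr -big_split; apply: eq_bigr => g _ /=.
by rewrite linearP scalerDl scalerA.
Qed.
HB.instance Definition _ :=
  GRing.isLinear.Build k H H _ glproj glproj_linear.

Lemma glproj_span v : glproj v \in glspan.
Proof. by apply: memv_suml => g _; rewrite memvZ // glval_span. Qed.

Lemma glproj_glval g : glproj (glval g) = glval g.
Proof.
rewrite /glproj (bigD1 g) //= glcoefE eqxx scale1r big1 ?addr0 // => h /negPf hg.
by rewrite glcoefE hg scale0r.
Qed.

Lemma glproj_id v : v \in glspan -> glproj v = v.
Proof.
suff /subvP h : (glspan <= fixedSpace (linfun glproj))%VS.
  by move/h/fixedSpaceP; rewrite lfunE.
apply/span_subvP => _ /mapP[g _ ->]; apply/fixedSpaceP.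
by rewrite lfunE /= glproj_glval.
Qed.

Lemma glspanP v : v \in glspan -> v = \sum_g (glcoef g v : k) *: glval g.
Proof. by move/glproj_id. Qed.

Definition glcoproj v : H := v - glproj v.

Lemma glcoproj_linear : linear glcoproj.
Proof. by move=> a x y; rewrite /glcoproj linearP opprD addrACA -scalerBr. Qed.
HB.instance Definition _ :=
  GRing.isLinear.Build k H H _ glcoproj glcoproj_linear.

Lemma glcoproj_eq0 v : (glcoproj v == 0) = (v \in glspan).
Proof.
apply/idP/idP => [|/glproj_id e]; last by rewrite /glcoproj e subrr.
by rewrite subr_eq0 => /eqP ->; apply: glproj_span.
Qed.

Lemma glspanMl g v : v \in glspan -> glval g * v \in glspan.
Proof.
move/glspanP=> ->; rewrite mulr_sumr memv_suml // => h _.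
by rewrite -scalerAr memvZ // -glvalM glval_span.
Qed.

Lemma glspanMr g v : v \in glspan -> v * glval g \in glspan.
Proof.
move/glspanP=> ->; rewrite mulr_suml memv_suml // => h _.
by rewrite -scalerAl memvZ // -glvalM glval_span.
Qed.

Lemma glspanMl_eq g v : (glval g * v \in glspan) = (v \in glspan).
Proof.
apply/idP/idP => [/(glspanMl g^-1%g)|]; last exact: glspanMl.
by rewrite mulrA glmulVr mul1r.
Qed.

Lemma glspanMr_eq g v : (v * glval g \in glspan) = (v \in glspan).
Proof.
apply/idP/idP => [/(glspanMr g^-1%g)|]; last exact: glspanMr.
by rewrite -mulrA glmulrV mulr1.
Qed.

Lemma grouplike_coradical v : grouplike v -> v \in coradical H.
Proof.
move=> gv; apply: memv_spanof; exists <[v]>%VS; last exact: memv_line.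
have v0 := grouplike_neq0 gv; split.
- rewrite /subcoalg limg_line -memvE comul_grouplike //.
  by apply: memv_tens; apply: memv_line.
- by rewrite -dimv_eq0 dim_vline v0.
move=> D _ Dv; have [->|D0] := eqVneq D 0%VS; first by left.
right; apply/eqP; rewrite eqEdim Dv dim_vline v0 lt0n dimv_eq0; exact: D0.
Qed.

(** A one-dimensional subcoalgebra is spanned by some c with Delta(c) = a c (x) c, and
    then a c is group-like. *)
Lemma coradicalE : pointed H -> coradical H = glspan.
Proof.
move=> Hpt; apply/eqP; rewrite eqEsubv; apply/andP; split; last first.
  apply/span_subvP => _ /mapP[g _ ->]; exact/grouplike_coradical/glvalP.
apply: spanof_sub => v [C sC]; have dC := Hpt C sC; case: sC => coC C0 _.
pose c := vpick C; have c0 : c != 0 by rewrite vpick0.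
have {}dC : C = <[c]>%VS.
  by apply/esym/eqP; rewrite eqEdim -memvE memv_pick dC dim_vline c0.
have [a ca] : exists a, comul c = a *: tens c c.
  apply/vlineP; have /subvP/(_ (comul c)) := coC.
  rewrite memv_img ?memv_pick // => /(_ isT); apply/subvP.
  rewrite dC; apply: tensv_ind => _ _ /vlineP[a1 ->] /vlineP[a2 ->].
  by rewrite tensZl tensZr !memvZ ?memv_line.
have ac : a * counit c = 1.
  have e : (a * counit c - 1) *: c = 0.
    have := lhit_counit c; rewrite lhitE ca linearZ /= lcontr_tens scalerA => e.
    by rewrite scalerBl scale1r e subrr.
  by move/eqP: e; rewrite scaler_eq0 (negPf c0) orbF subr_eq0 => /eqP.
have a0 : a != 0.
  by apply: contra_eq_neq ac => ->; rewrite mul0r eq_sym oner_neq0.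
have gac : grouplike (a *: c).
  by rewrite /grouplike !linearZ /= ca tensZl eqxx -[_ *: _]/(a * _) ac eqxx.
rewrite dC => /vlineP[b ->]; rewrite -[c]scale1r -(mulVf a0) -scalerA.
do 2!apply: memvZ.
by have [g ->] := glval_onto gac; apply: glval_span.
Qed.

End GrouplikeGroup.
Arguments glval {k H} g : simpl never.

(** * The Taft-Wilson decomposition of H_1 *)

Section FirstTerm.
Variables (k : fieldType) (H : hopfAlgType k).
Implicit Types (u v w x y : H) (g h b : glgroup H) (t : tensor H H).

(** With P = [glproj] this is 1 = P (x) 1 + 1 (x) P - P (x) P + (1-P) (x) (1-P), where
    the first three terms are written in the basis of group-likes. *)
Lemma tensor_glproj t :
  t = \sum_g tens (glval g) (lcontr (glcoef g) t)
    + \sum_h tens (rcontr (glcoef h) t) (glval h)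
    - \sum_g \sum_h (glcoef h (lcontr (glcoef g) t) : k) *: tens (glval g) (glval h)
    + tmap (@glcoproj k H) (@glcoproj k H) t.
Proof.
elim/tens_ind: t => [u v|s t IHs IHt]; last first.
  rewrite {1}IHs {1}IHt !linearD /=.
  under [X in _ = X + _ - _ + _]eq_bigr => g _ do rewrite linearD linearD /=.
  under [X in _ = _ + X - _ + _]eq_bigr => g _ do rewrite linearD tensDl /=.
  under [X in _ = _ + _ - X + _]eq_bigr => g _.
    under eq_bigr => h _ do rewrite !linearD scalerDl /=.
    rewrite big_split; over.
  rewrite !big_split /= opprD.
  by rewrite addrACA; congr (_ + _); rewrite addrACA; congr (_ + _); rewrite addrACA.
rewrite tmap_tens; try exact: linearP.
have -> : \sum_g tens (glval g) (lcontr (glcoef g) (tens u v)) = tens (glproj u) v.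
  rewrite /glproj tens_suml; apply: eq_bigr => g _.
  by rewrite lcontr_tens tensZl tensZr.
have -> : \sum_h tens (rcontr (glcoef h) (tens u v)) (glval h) = tens u (glproj v).
  rewrite /glproj linear_sum; apply: eq_bigr => g _ /=.
  by rewrite rcontr_tens tensZl tensZr.
have -> : \sum_g \sum_h (glcoef h (lcontr (glcoef g) (tens u v)) : k)
    *: tens (glval g) (glval h) = tens (glproj u) (glproj v).
  rewrite {1}/glproj tens_suml; apply: eq_bigr => g _.
  rewrite /glproj linear_sum; apply: eq_bigr => h _ /=.
  by rewrite lcontr_tens linearZ /= tensZl tensZr scalerA.
rewrite /glcoproj !tensBl ![tens _ (v - _)]linearB /=.
set T := tens u v; set A := tens _ v; set B := tens u _; set C := tens _ _.
by rewrite [A + B - C]addrAC -[T - B - _]addrA -opprD [B + _]addrC [RHS]addrC subrK.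
Qed.

Lemma lhit_rhit (f f' : 'Hom(H, k^o)) x : lhit f (rhit f' x) = rhit f' (lhit f x).
Proof.
rewrite [lhit f (rhit _ _)]lhitE comul_rhit [lhit f x]lhitE.
elim/tens_ind: (comul x) => [u v|s t IHs IHt]; last by rewrite !linearD /= IHs IHt.
rewrite tmap_tens ?lcontr_tens ?linearZ //; exact: linearP.
Qed.

(** Membership of x in H_1 says that (1-P) (x) (1-P) kills Delta(x), so that
    Delta(x) = sum g (x) v_g + sum u_h (x) h - sum e(g,h) g (x) h.  Coassociativity
    propagates this shape to v_g and then to y(g,h) = [lhit] of u_h, with
    Delta(y) = g (x) y + y (x) h - e g (x) h; hence y - e g is (g,h)-skew-primitive.
    The counit recovers x from the v_g, and each v_g from the y(g,h), modulo kG. *)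
Lemma Taft_Wilson x : pointed H -> x \in coradical1 H ->
  exists w : glgroup H -> glgroup H -> H,
    (forall g h, skewprim (glval g) (glval h) (w g h)) /\
    (x - \sum_g \sum_h w g h)%R \in glspan H.
Proof.
move=> Hpt; rewrite -memv_preim coradicalE // => xH1.
pose v g := lhit (glcoef g) x; pose u h := rhit (glcoef h) x.
pose e g h : k := glcoef h (v g).
have Dx : comul x = \sum_g tens (glval g) (v g) + \sum_h tens (u h) (glval h)
    - \sum_g \sum_h e g h *: tens (glval g) (glval h).
  rewrite [LHS]tensor_glproj [tmap _ _ _](_ : _ = 0) ?addr0.
    rewrite /e /v /u; congr (_ + _ - _); apply: eq_bigr => g _.
    - by rewrite lhitE.
    - by rewrite rhitE.
    by apply: eq_bigr => h _; rewrite lhitE.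
  suff /subvP h : (tensv fullv (glspan H) + tensv (glspan H) fullv <=
      lker (linfun (tmap (@glcoproj k H) (@glcoproj k H))))%VS.
    by apply/eqP; have := h _ xH1; rewrite memv_ker lfunE.
  rewrite subv_add; apply/andP; split; apply: tensv_ind => u' v' h1 h2;
    rewrite memv_ker lfunE /= tmap_tens; try exact: linearP.
    by move: h2; rewrite -glcoproj_eq0 => /eqP ->; rewrite linear0.
  by move: h1; rewrite -glcoproj_eq0 => /eqP ->; rewrite tens0l.
have tm_l f (u' v' : H) : tmap (lhit f) id (tens u' v') = tens (lhit f u') v'.
  by rewrite tmap_tens //; apply: linearP.
have tm_r f (u' v' : H) : tmap id (rhit f) (tens u' v') = tens u' (rhit f v').
  by rewrite tmap_tens //; apply: linearP.
pose y g h := lhit (glcoef g) (u h).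
have Dv g : comul (v g) = tens (glval g) (v g) + \sum_h tens (y g h) (glval h)
    - \sum_h e g h *: tens (glval g) (glval h).
  have lg g' : lhit (glcoef g) (glval g') = (g == g')%:R *: glval g'.
    by rewrite lhit_grouplike ?glvalP // glcoefE.
  rewrite comul_lhit Dx linearB linearD /=; congr (_ + _ - _).
  - rewrite linear_sum (bigD1 g) //= big1 => [|g' g'g].
      by rewrite tm_l lg eqxx scale1r addr0.
    by rewrite tm_l lg eq_sym (negPf g'g) scale0r tens0l.
  - by rewrite linear_sum; apply: eq_bigr => h _ /=; rewrite tm_l.
  rewrite linear_sum (bigD1 g) //= [X in _ + X]big1 => [|g' g'g].
    rewrite addr0 linear_sum; apply: eq_bigr => h _ /=.
    by rewrite linearZ /= tm_l lg eqxx scale1r.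
  rewrite linear_sum big1 // => h _ /=.
  by rewrite linearZ /= tm_l lg eq_sym (negPf g'g) scale0r tens0l scaler0.
have Dy g h : comul (y g h) = tens (glval g) (y g h) + tens (y g h) (glval h)
    - e g h *: tens (glval g) (glval h).
  have rh h' : rhit (glcoef h) (glval h') = (h == h')%:R *: glval h'.
    by rewrite rhit_grouplike ?glvalP // glcoefE.
  have yE : y g h = rhit (glcoef h) (v g) by rewrite /y /u lhit_rhit.
  rewrite {1}yE comul_rhit Dv linearB linearD /= tm_r -yE.
  congr (_ + _ - _).
    rewrite linear_sum (bigD1 h) //= big1 => [|h' h'h].
      by rewrite tm_r rh eqxx scale1r addr0.
    by rewrite tm_r rh eq_sym (negPf h'h) scale0r linear0.
  rewrite linear_sum (bigD1 h) //= [X in _ + X]big1 => [|h' h'h].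
    by rewrite linearZ /= tm_r rh eqxx scale1r addr0.
  by rewrite linearZ /= tm_r rh eq_sym (negPf h'h) scale0r linear0 scaler0.
exists (fun g h => y g h - e g h *: glval g); split=> [g h|].
  rewrite /skewprim linearB linearZ /= Dy comul_grouplike ?glvalP // tensBl.
  rewrite [tens (glval g) (_ - _)]linearB /= tensZl tensZr.
  by rewrite [RHS]addrC [RHS]addrACA -[LHS]addrA; congr (_ + _); rewrite addrC.
have Ev g : v g - \sum_h (y g h - e g h *: glval g) \in glspan H.
  have rg (z : H) h : rcontr counit (tens z (glval h)) = z.
    by rewrite rcontr_tens counit_grouplike ?glvalP // scale1r.
  have := rhit_counit (v g); rewrite rhitE Dv linearB linearD /= rcontr_tens.
  have -> : rcontr counit (\sum_h tens (y g h) (glval h)) = \sum_h y g h.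
    by rewrite linear_sum; apply: eq_bigr => h _ /=; rewrite rg.
  have -> : rcontr counit (\sum_h e g h *: tens (glval g) (glval h)) =
      \sum_h e g h *: glval g.
    by rewrite linear_sum; apply: eq_bigr => h _ /=; rewrite linearZ /= rg.
  by rewrite -addrA -sumrB => {1}<-; rewrite addrK memvZ // glval_span.
have lg g (z : H) : lcontr counit (tens (glval g) z) = z.
  by rewrite lcontr_tens counit_grouplike ?glvalP // scale1r.
have := lhit_counit x; rewrite lhitE Dx linearB linearD /=.
have -> : lcontr counit (\sum_g tens (glval g) (v g)) = \sum_g v g.
  by rewrite linear_sum; apply: eq_bigr => g _ /=; rewrite lg.
move=> {1}<-; rewrite -[X in X - \sum_g \sum_h (_ - _)]addrA addrAC memvD //; first by rewrite -sumrB memv_suml.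
rewrite memvB // linear_sum memv_suml // => h _ /=.
  by rewrite lcontr_tens memvZ // glval_span.
rewrite linear_sum memv_suml // => h' _ /=; rewrite linearZ /= lg.
by rewrite memvZ // glval_span.
Qed.

(** A (g,h)-skew-primitive element is g times a (1, g^-1 h)-skew-primitive one. *)
Lemma coradical1_ind (W : {vspace H}) : pointed H ->
  (forall g, glval g \in W) ->
  (forall g b y, skewprim 1 (glval b) y -> glval g * y \in W) ->
  (coradical1 H <= W)%VS.
Proof.
move=> Hpt Wg Wy; apply/subvP => x /(Taft_Wilson Hpt)[w [sw xw]].
rewrite -(subrK (\sum_g \sum_h w g h) x) memvD //.
  by rewrite (glspanP xw) memv_suml // => g _; rewrite memvZ.
apply: memv_suml => g _; apply: memv_suml => h _.
rewrite -[w g h]mul1r -(glmulrV g) -mulrA; apply: (Wy _ (g^-1 * h)%g).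
by have := skewprimMl (glvalP g^-1%g) (sw g h); rewrite glmulVr.
Qed.

Lemma glval_coradical1 g : glval g \in coradical1 H.
Proof.
have gg := glvalP g; rewrite -memv_preim comul_grouplike //.
apply: subvP (addvSl _ _) _ _; apply: memv_tens; first exact: memvf.
exact: grouplike_coradical.
Qed.

Lemma skewprim_coradical1 g h y : skewprim (glval g) (glval h) y -> y \in coradical1 H.
Proof.
move=> sy; rewrite -memv_preim sy; apply: memv_add; apply: memv_tens;
  by rewrite ?memvf ?grouplike_coradical ?glvalP.
Qed.

End FirstTerm.

(** * Rank one: a single skew-primitive element *)

Section RankOne.
Variables (k : fieldType) (H : hopfAlgType k).
Hypotheses (Hpt : pointed H) (Hrk : has_rank H 1).
Implicit Types (u v w x y : H) (g h a b : glgroup H).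

Lemma skewprim_glval g b y : skewprim 1 (glval b) y ->
  skewprim (glval g) (glval (g * b)%g) (glval g * y).
Proof. by move/(skewprimMl (glvalP g)); rewrite mulr1. Qed.

(** A linear map on H whose restriction to H_1 factors through k (x)_{kG} H_1: the sum
    over g pulls the part of Delta(v) in g (x) H back by g^-1 and reads it modulo
    kG.  Values on kG and on skew-primitives lie in complementary subspaces. *)
Definition coinv v : H := (counit v : k) *: 1
  + \sum_g glcoproj (glval g^-1%g * lhit (glcoef g) v).

Lemma coinv_linear : linear coinv.
Proof.
move=> c x y; rewrite /coinv linearP scalerDl scalerDr -scalerA addrACA.
congr (_ + _); rewrite scaler_sumr -big_split; apply: eq_bigr => g _ /=.
by rewrite linearP mulrDr -scalerAr linearP.
Qed.
HB.instance Definition _ := GRing.isLinear.Build k H H _ coinv coinv_linear.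

Lemma coinv_glval g : coinv (glval g) = 1.
Proof.
rewrite /coinv counit_grouplike ?glvalP // scale1r big1 ?addr0 // => h _.
apply/eqP; rewrite glcoproj_eq0 lhit_grouplike ?glvalP // -scalerAr memvZ //.
by rewrite -glvalM glval_span.
Qed.

Lemma coinv_skewprim g b y : skewprim 1 (glval b) y ->
  coinv (glval g * y) = glcoproj y.
Proof.
move=> sy; have sgy := skewprim_glval g sy.
rewrite /coinv (counit_skewprim _ _ sgy) ?glvalP // scale0r add0r (bigD1 g) //=.
have coeff h : glcoproj (glval h^-1%g * lhit (glcoef h) (glval g * y)) =
    (h == g)%:R *: glcoproj (glval h^-1%g * (glval g * y)).
  rewrite (lhit_skewprim _ sgy) glcoefE mulrDr linearD /= -!scalerAr linearZ /=.
  rewrite -glvalM (_ : glcoproj (glval _) = 0) ?scaler0 ?add0r ?linearZ //.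
  by apply/eqP; rewrite glcoproj_eq0 glval_span.
rewrite coeff eqxx scale1r mulrA glmulVr mul1r big1 ?addr0 // => h /negPf hg.
by rewrite coeff hg scale0r.
Qed.

Lemma coinv_glspan_mul v x : v \in glspan H -> x \in coradical1 H ->
  coinv (v * x) = (counit v : k) *: coinv x.
Proof.
move=> vs; suff glx g : x \in coradical1 H -> coinv (glval g * x) = coinv x.
  move=> /[dup] xH1 /glx {}glx; rewrite (glspanP vs) mulr_suml !linear_sum scaler_suml /=.
  apply: eq_bigr => g _; rewrite -scalerAl !linearZ /= glx.
  by rewrite counit_grouplike ?glvalP //; congr (_ *: _); apply/esym/mulr1.
suff /subvP hs : (coradical1 H <=
    lker ((linfun coinv \o amull (glval g))%VF - linfun coinv))%VS.
  by move/hs/eqlfunP; rewrite comp_lfunE !lfunE.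
apply: coradical1_ind => // [h|h b y sy]; apply/eqlfunP;
  rewrite comp_lfunE !lfunE /=.
  by rewrite -glvalM !coinv_glval.
by rewrite mulrA -glvalM !(coinv_skewprim _ sy).
Qed.

Definition coinv_tensor : tensor k^o H -> H :=
  tlift (fun (c : k^o) x => (c : k) *: coinv x).
HB.instance Definition _ := GRing.Linear.copy coinv_tensor (tlift _).

Lemma coinv_tensorE (c : k^o) x : coinv_tensor (tens c x) = (c : k) *: coinv x.
Proof.
rewrite /coinv_tensor tlift_tens // => [w|d] b y z.
  by rewrite scalerDl scalerA.
by rewrite [coinv _]linearP scalerDr !scalerA mulrC.
Qed.

Lemma balancing_coinv : (balancing H <= lker (linfun coinv_tensor))%VS.
Proof.
apply: spanof_sub => _ [c [v [x [vH0 xH1 ->]]]].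
rewrite coradicalE // in vH0.
rewrite memv_ker lfunE /= linearB /= !coinv_tensorE coinv_glspan_mul //.
by rewrite scalerA subrr.
Qed.

Let U := tensv {: k^o} (coradical1 H).
Let B := balancing H.

(** If all (1,b)-skew-primitives were in kG, then H_1 = kG and the quotient that defines the
    rank would be spanned by the class of 1 (x) 1. *)
Lemma exists_skewprim : exists a x, skewprim 1 (glval a) x /\ x \notin glspan H.
Proof.
apply: contrapT => hN.
have sH1 : (coradical1 H <= glspan H)%VS.
  apply: coradical1_ind => // [g|g b y sy]; first exact: glval_span.
  rewrite glspanMl_eq; apply: contraT => ys; case: hN; by exists b, y.
(* For x = g, the balancing relation between c (x) g and eps(g) c (x) 1. *)
have sU : (U <= <[tens (1 : k^o) (1 : H)]> + B)%VS.
  apply: tensv_ind => c x _ /(subvP sH1) /glspanP ->.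
  rewrite linear_sum memv_suml // => g _ /=; rewrite linearZ /= memvZ //.
  rewrite -[tens c _](subrK (c *: tens (1 : k^o) (1 : H))) addrC memv_add //.
    by rewrite memvZ ?memv_line.
  rewrite -memvN opprB; apply: memv_spanof; exists c, (glval g), 1.
  rewrite grouplike_coradical ?glvalP // -glval1 glval_coradical1; split=> //.
  rewrite glval1 mulr1 counit_grouplike ?glvalP // mulr1; congr (_ - _).
  by rewrite -tensZl; congr tens; apply: mulr1.
have := dimvS sU; have := dimv_cap_compl U B; rewrite Hrk.
have := dimv_sum_cap U B.
have : (\dim (U + B) <= 1 + \dim B)%N.
  apply: leq_trans (dimvS (_ : _ <= <[tens (1 : k^o) (1 : H)]> + B)%VS) _.
    by rewrite subv_add sU addvSr.
  apply: leq_trans (dimv_add_leqif _ _) _; by rewrite leq_add2r dim_vline leq_b1.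
lia.
Qed.

(** The image of k (x) H_1 under [coinv_tensor] has dimension at most 2, since it is a
    quotient of the space that defines the rank.  It contains 1 and the class of x,
    hence equals their span, and it contains the class of y. *)
Lemma skewprim_unique a x b y :
  skewprim 1 (glval a) x -> x \notin glspan H -> skewprim 1 (glval b) y ->
  exists c : k, y - c *: x \in glspan H.
Proof.
move=> sx xs sy; pose L := linfun coinv_tensor.
have dL : (\dim (L @: U) <= 2)%N.
  have le : (\dim (U :&: B) <= \dim (U :&: lker L))%N.
    exact/dimvS/(capvS (subvv U) balancing_coinv).
  have := limg_ker_dim L U; have := dimv_cap_compl U B; rewrite Hrk => <-.
  by move=> e; rewrite -(leq_add2l (\dim (U :&: lker L))) e leq_add2r.
have LU v : v \in coradical1 H -> coinv v \in (L @: U)%VS.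
  move=> vH1; have <- : L (tens (1 : k^o) v) = coinv v.
    by rewrite lfunE /= coinv_tensorE scale1r.
  by rewrite memv_img // memv_tens ?memvf.
have Ls c z : skewprim 1 (glval c) z -> glcoproj z \in (L @: U)%VS.
  move=> sz; rewrite -(coinv_skewprim 1%g sz) glval1 mul1r LU //.
  exact: (@skewprim_coradical1 _ _ 1%g c).
have L1 : 1 \in (L @: U)%VS.
  by rewrite -(coinv_glval 1%g) LU // glval_coradical1.
have coproj_id v : glcoproj (glcoproj v) = glcoproj v.
  rewrite {2}/glcoproj linearB /= [glcoproj (glproj v)](_ : _ = 0) ?subr0 //.
  by apply/eqP; rewrite glcoproj_eq0 glproj_span.
have coproj1 : glcoproj (1 : H) = 0.
  by apply/eqP; rewrite glcoproj_eq0 -glval1 glval_span.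
have x0 : glcoproj x != 0 by rewrite glcoproj_eq0.
pose X : seq H := [:: 1; glcoproj x].
have fr : free X.
  rewrite free_cons seq1_free x0 andbT span_seq1; apply/negP => /vlineP[c e].
  have := oner_neq0 H; have := congr1 (@glcoproj k H) e.
  by rewrite linearZ /= coproj1 coproj_id -e => ->; rewrite eqxx.
have LE : <<X>>%VS = (L @: U)%VS.
  apply/eqP; rewrite eqEdim (eqP fr) dL andbT.
  by apply/span_subvP => v; rewrite !inE => /orP[] /eqP -> //; apply: Ls sx.
have := Ls _ _ sy; rewrite -LE span_cons span_seq1.
case/memv_addP=> _ /vlineP[c ->] [_ /vlineP[d ->]] /(congr1 (@glcoproj k H)).
rewrite coproj_id linearD !linearZ /= coproj1 scaler0 add0r coproj_id => e.
by exists d; rewrite -glcoproj_eq0 linearB linearZ /= e subrr.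
Qed.

End RankOne.

(** * Quantum binomial coefficients *)

Section QuantumBinomial.
Variables (k : fieldType) (q : k).

Definition qint n : k := \sum_(i < n) q ^+ i.

Lemma qintS n : qint n.+1 = 1 + q * qint n.
Proof.
rewrite /qint big_ord_recl mulr_sumr; congr (_ + _).
by apply: eq_bigr => i _; rewrite exprS.
Qed.

Lemma qint1 : qint 1 = 1.
Proof. by rewrite /qint big_ord1 expr0. Qed.

(** Gaussian binomial coefficients, by Pascal's rule since quantum factorials may
    vanish when q is a root of unity. *)
Fixpoint qbin n j : k :=
  match n, j with
  | _, 0 => 1
  | 0, _.+1 => 0
  | n'.+1, j'.+1 => qbin n' j' + q ^+ j * qbin n' j
  end.

Lemma qbin0 n : qbin n 0 = 1. Proof. by case: n. Qed.

Lemma qbinS n j : qbin n.+1 j.+1 = qbin n j + q ^+ j.+1 * qbin n j.+1.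
Proof. by []. Qed.

Lemma qbin_small n j : (n < j)%N -> qbin n j = 0.
Proof.
elim: n j => [|n IHn] [|j] // nj.
by rewrite qbinS !IHn ?mulr0 ?addr0 //; lia.
Qed.

Lemma qbin_diag n : qbin n n = 1.
Proof. by elim: n => // n IHn; rewrite qbinS IHn qbin_small // mulr0 addr0. Qed.

Arguments qbin : simpl never.

(** The absorption identity replaces division by quantum factorials: it yields the
    vanishing of the middle coefficients as soon as [n]_q = 0. *)
Lemma qint_qbin n j : qint j.+1 * qbin n.+1 j.+1 = qint n.+1 * qbin n j.
Proof.
elim: n j => [|n IHn] [|j].
- by rewrite qbinS !qbin0 mulr0 addr0.
- by rewrite qbinS !qbin_small // !(mulr0, addr0).
- have e : qbin n.+1 1 = qint n.+1.
    by have := IHn 0; rewrite qbin0 qint1 mul1r mulr1.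
  by rewrite (qbinS n.+1) !qbin0 qint1 mul1r mulr1 (qintS n.+1) e expr1.
have := IHn j.+1; have := IHn j; have := qbinS n j.
rewrite (qbinS n.+1) (qintS n.+1) (qintS j.+1) [q ^+ j.+2]exprS.
move: (qbin n.+1 j.+1) (qbin n.+1 j.+2) (qbin n j) (qbin n j.+1) => Q Q' b b'.
move: (qint n.+1) (qint j.+1) (q ^+ j.+1) => N J P eQ eJ eQ'.
have -> : (1 + q * J) * (Q + q * P * Q') = (1 + q * J) * Q + q * P * ((1 + q * J) * Q').
  by ring.
rewrite eQ'; have -> : q * P * (N * b') = q * (N * Q - N * b) by rewrite eQ; ring.
by rewrite -eJ; ring.
Qed.

Lemma qbin_qchar n j : qint n = 0 -> qint j != 0 -> (0 < j)%N -> (0 < n)%N -> qbin n j = 0.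
Proof.
case: n j => // n [//|j] n0 j0 _ _; apply: (mulfI j0).
by rewrite qint_qbin n0 mul0r mulr0.
Qed.

Lemma qbin1 n : qbin n.+1 1 = qint n.+1.
Proof.
by have := qint_qbin n 0; rewrite qbin0 mulr1 qint1 mul1r.
Qed.

Variable R : algType k.

Lemma qcommX (A B : R) j : A * B = q *: (B * A) -> A * B ^+ j = q ^+ j *: (B ^+ j * A).
Proof.
move=> AB; elim: j => [|j IHj]; first by rewrite !expr0 mulr1 mul1r scale1r.
by rewrite !exprSr mulrA IHj -scalerAl -[_ * A * B]mulrA AB -scalerAr scalerA mulrA.
Qed.

Lemma qexprD (A B : R) n : A * B = q *: (B * A) ->
  (A + B) ^+ n = \sum_(j < n.+1) qbin n j *: (B ^+ j * A ^+ (n - j)).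
Proof.
move=> AB; elim: n => [|n IHn]; first by rewrite big_ord1 !expr0 mulr1 scale1r.
rewrite exprS IHn mulrDl !mulr_sumr [RHS]big_ord_recl /= subn0 expr0 mul1r.
rewrite big_ord_recl /= -scalerAr qbin0 scale1r mul1r subn0 -exprS -addrA.
rewrite scale1r; congr (_ + _).
under [RHS]eq_bigr => j _ do rewrite /bump /= add1n subSS qbinS scalerDl.
rewrite big_split /= addrC; congr (_ + _).
  by apply: eq_bigr => j _; rewrite -scalerAr mulrA -exprS.
rewrite [RHS]big_ord_recr /= qbin_small // mulr0 scale0r addr0.
apply: eq_bigr => j _; rewrite /bump /= add1n -scalerAr mulrA (qcommX _ AB).
rewrite -scalerAl scalerA [qbin _ _ * _]mulrC -mulrA -exprS.
by congr (_ *: (_ * _ ^+ _)); have := ltn_ord j; lia.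
Qed.

Lemma qexprD_qchar (A B : R) n : A * B = q *: (B * A) -> (0 < n)%N -> qint n = 0 ->
  (forall m, (0 < m < n)%N -> qint m != 0) -> (A + B) ^+ n = A ^+ n + B ^+ n.
Proof.
case: n => // n AB _ qn qm; rewrite (qexprD _ AB) big_ord_recl big_ord_recr /=.
rewrite qbin0 expr0 scale1r mul1r subn0; congr (_ + _).
rewrite big1 ?add0r => [|j _].
  by rewrite /bump /= add1n qbin_diag scale1r subnn mulr1.
by rewrite /bump /= add1n qbin_qchar ?scale0r // qm //= ltnS ltn_ord.
Qed.
End QuantumBinomial.
Arguments qbin {k} q n j : simpl never.

(** * Powers of a skew-primitive element *)

Section SkewPowers.
Variables (k : fieldType) (H : hopfAlgType k) (a : glgroup H) (x : H) (q : k).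
Hypotheses (sx : skewprim 1 (glval a) x) (xs : x \notin glspan H).
Hypothesis ax : glval a * x = q *: (x * glval a).
Implicit Types (g h : glgroup H) (v w : H) (n m i j : nat).

Lemma tensX v w n : tens v w ^+ n = tens (v ^+ n) (w ^+ n) :> tensor H H.
Proof. by elim: n => [|n IHn] //; rewrite !exprS IHn tensM. Qed.

Lemma skewprim_qcomm :
  tens x (glval a) * tens 1 x = q *: (tens 1 x * tens x (glval a)) :> tensor H H.
Proof. by rewrite !tensM mulr1 mul1r ax tensZr. Qed.

Lemma comul_skewprimX m : comul (x ^+ m) =
  \sum_(j < m.+1) qbin q m j *: tens (x ^+ (m - j)) (x ^+ j * glval a ^+ (m - j)).
Proof.
rewrite rmorphXn /= sx (qexprD _ skewprim_qcomm); apply: eq_bigr => j _.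
by rewrite !tensX tensM expr1n mul1r.
Qed.

Lemma skewprim_qchar n : (0 < n)%N -> qint q n = 0 ->
  (forall m, (0 < m < n)%N -> qint q m != 0) ->
  skewprim 1 (glval (a ^+ n)%g) (x ^+ n).
Proof.
move=> n0 qn qm; rewrite /skewprim rmorphXn /= sx.
by rewrite (qexprD_qchar skewprim_qcomm) // !tensX expr1n glvalX.
Qed.

Definition powseq n : seq H :=
  [seq glval g * x ^+ j | g <- enum (glgroup H : predArgType), j <- iota 0 n].

Definition powspan n : {vspace H} := <<powseq n>>%VS.

Lemma mem_powspan g j n : (j < n)%N -> glval g * x ^+ j \in powspan n.
Proof. by move=> jn; apply/memv_span/allpairs_f; rewrite ?mem_enum ?mem_iota. Qed.

Lemma powspan_ind n (W : {vspace H}) :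
  (forall g j, (j < n)%N -> glval g * x ^+ j \in W) -> (powspan n <= W)%VS.
Proof.
move=> h; apply/span_subvP => v /allpairsP[[g j] [/= _ jn ->]].
by apply: h; move: jn; rewrite mem_iota.
Qed.

(** For f vanishing on kG, v |-> v_1 f(v_2) is a lowering operator: the term j = 0 of
    the binomial expansion is killed by f, the term j = 1 has coefficient [m+1]_q,
    and the others have lower degree in x. *)
Lemma rhit_powers (f : 'Hom(H, k^o)) g m :
  {in glspan H, forall v, f v = 0} ->
  rhit f (glval g * x ^+ m.+1) - ((qint q m.+1 * f (glval g * (x * glval a ^+ m)) : k)
    *: (glval g * x ^+ m)) \in powspan m.
Proof.
move=> f0; rewrite rhitE rmorphM /= comul_grouplike ?glvalP // comul_skewprimX.
rewrite mulr_sumr linear_sum /=.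
have E j : rcontr f (tens (glval g) (glval g) * (qbin q m.+1 j
     *: tens (x ^+ (m.+1 - j)) (x ^+ j * glval a ^+ (m.+1 - j)))) =
   (qbin q m.+1 j * f (glval g * (x ^+ j * glval a ^+ (m.+1 - j))) : k)
     *: (glval g * x ^+ (m.+1 - j)).
  by rewrite -scalerAr tensM linearZ /= rcontr_tens scalerA.
under eq_bigr => j _ do rewrite E.
rewrite 2!big_ord_recl /= {1}/bump /= f0 ?mulr0 ?scale0r ?add0r; last first.
  by rewrite expr0 mul1r -glvalX -glvalM glval_span.
rewrite [X in X + _ - _](_ : _ = (qint q m.+1 * f (glval g * (x * glval a ^+ m)) : k)
    *: (glval g * x ^+ m)).
  rewrite addrC addKr memv_suml // => j _; rewrite /bump /= memvZ //.
  by rewrite mem_powspan //; have := ltn_ord j; lia.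
by rewrite subSS subn0 /bump /= expr1 qbin1.
Qed.

Lemma rhit_powspan (f : 'Hom(H, k^o)) m v : {in glspan H, forall v, f v = 0} ->
  v \in powspan m.+1 -> rhit f v \in powspan m.
Proof.
move=> f0; suff /subvP h : (powspan m.+1 <= rhit f @^-1: powspan m)%VS.
  by move/h; rewrite -memv_preim.
apply: powspan_ind => g [|j] jm; rewrite -memv_preim.
  by rewrite mulr1 rhit_grouplike ?glvalP // f0 ?glval_span // scale0r mem0v.
have := rhit_powers g j f0 => /(subvP _) h.
rewrite -(subrK ((qint q j.+1 * f (glval g * (x * glval a ^+ j)) : k)
    *: (glval g * x ^+ j)) (rhit f _)) memvD //; last first.
  by rewrite memvZ // mem_powspan.
apply: h; apply: powspan_ind => h i ij; apply: mem_powspan; lia.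
Qed.

(** Lower the degree of a relation, with f equal to 1 at the element
    g x a^m outside kG: the induction hypothesis kills c(g) [m+1]_q, and [m+1]_q is
    nonzero. *)
Lemma powers_independent n m : (forall m, (0 < m < n)%N -> qint q m != 0) ->
  (m < n)%N -> forall c : glgroup H -> k,
  \sum_g c g *: (glval g * x ^+ m) \in powspan m -> forall g, c g = 0.
Proof.
move=> qm; elim: m => [|m IHm] mn c.
  move=> h0 g; have /eqP : \sum_g c g *: (glval g * x ^+ 0) == 0.
    rewrite -memv0; apply: subvP h0; exact: powspan_ind.
  move/(congr1 (glcoef g)); rewrite linear0 linear_sum (bigD1 g) //= big1 => [|h /negPf hg].
    by rewrite linearZ /= mulr1 glcoefE eqxx addr0 => <-; apply/esym/mulr1.
  by rewrite linearZ /= mulr1 glcoefE eq_sym hg; apply: mulr0.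
move=> cm g; have gx : glval g * (x * glval a ^+ m) \notin glspan H.
  by rewrite glspanMl_eq -glvalX glspanMr_eq.
have [f [f0 f1]] := separating_functional gx.
pose d h : k := c h * (qint q m.+1 * f (glval h * (x * glval a ^+ m))).
suff : d g = 0.
  rewrite /d f1 => /eqP; rewrite mulf_eq0 => /orP[/eqP//|].
  by rewrite -[_ * 1]/(_ *: (1 : k^o)) [_ *: _]mulr1 (negPf (qm _ _)).
apply: IHm; first exact: ltnW.
have := rhit_powspan f0 cm; rewrite linear_sum => h.
rewrite -[X in X \in _](subKr (\sum_h rhit f (c h *: (glval h * x ^+ m.+1)))).
rewrite memvB // -sumrB memv_suml // => l _; rewrite linearZ /= /d -scalerA -scalerBr.
by rewrite memvZ // rhit_powers.
Qed.

Lemma powers_free n : (forall m, (0 < m < n)%N -> qint q m != 0) ->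
  free (powseq n).
Proof.
move=> qm.
pose b (p : glgroup H * nat) := glval p.1 * x ^+ p.2.
set r := [seq (g, j) | g <- enum (glgroup H : predArgType), j <- iota 0 n].
have -> : powseq n = map b r by rewrite map_allpairs.
apply: freeP_family => [|c].
  by apply: allpairs_uniq => [||[? ?] [? ?] _ _] //; rewrite ?enum_uniq ?iota_uniq.
rewrite big_allpairs_dep /=.
have -> : iota 0 n = index_iota 0 n by rewrite /index_iota subn0.
under eq_bigr => g _ do rewrite big_mkord.
rewrite exchange_big /= => c0.
(* Descending induction on the degree j: the terms of degree above j vanish already,
   so those of degree j lie in the span of the lower ones. *)
suff main m : (m <= n)%N -> forall (j : 'I_n) g, (n - m <= j)%N -> c (g, nat_of_ord j) = 0.
  move=> _ /allpairsP[[g j] [/= _ jn ->]]; rewrite mem_iota /= in jn.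
  by apply: (main n (leqnn _) (Ordinal jn)); rewrite subnn.
elim: m => [|m IHm] mn j g nj; first by have := ltn_ord j; lia.
have [nmj|] := leqP (n - m) j; first by apply: IHm => //; apply: ltnW.
move=> jnm; move: g; apply: (powers_independent qm (ltn_ord j)).
move/eqP: c0; rewrite (bigD1 j) //= addr_eq0 big_enum /= => /eqP ->.
rewrite memvN memv_suml // => i ij; rewrite memv_suml // => g _.
have [ji|] := leqP j i.
  rewrite IHm ?scale0r ?mem0v //; first exact: ltnW.
  by move: ij; rewrite -val_eqE /=; lia.
by move=> ltij; rewrite memvZ // /b /= mem_powspan.
Qed.

End SkewPowers.

(** * Conjugation by group-likes, and a basis of H *)

Section SkewClassification.
Variables (k : fieldType) (H : hopfAlgType k).
Hypotheses (Hpt : pointed H) (Hrk : has_rank H 1).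
Variables (a : glgroup H) (x : H).
Hypotheses (sx : skewprim 1 (glval a) x) (xs : x \notin glspan H).
Implicit Types (g h b : glgroup H) (y z : H).

(** Contract the first leg of Delta(z) with the coefficient functional of 1:
    computed in kG it gives e(z) 1, and computed from the skew-primitivity e(z) b + z. *)
Lemma glspan_skewprim b z : z \in glspan H -> skewprim 1 (glval b) z ->
  exists d : k, z = d *: (glval b - 1).
Proof.
move=> zs sz; exists (- glcoef 1%g z).
have := lhit_skewprim (glcoef 1%g) sz; rewrite -glval1 glcoefE eqxx scale1r.
rewrite {1}(glspanP zs) linear_sum (bigD1 1%g) //= big1 => [|g g1].
  rewrite addr0 linearZ /= lhit_grouplike ?glvalP // glcoefE eqxx scale1r.
  by rewrite scaleNr scalerBr opprB => ->; rewrite addrC addKr.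
by rewrite linearZ /= lhit_grouplike ?glvalP // glcoefE eq_sym (negPf g1) scale0r scaler0.
Qed.

(** If the class of y modulo kG is a nonzero multiple of that of x, a functional
    that vanishes on kG but not at x compares the group-likes b and a. *)
Lemma skewprim_classify b y : skewprim 1 (glval b) y ->
  (b = a /\ exists c d : k, y = c *: x + d *: (glval a - 1)) \/
  exists d : k, y = d *: (glval b - 1).
Proof.
move=> sy; have [c yc] := skewprim_unique Hpt Hrk sx xs sy.
have [c0|c0] := eqVneq c 0.
  by right; move: yc; rewrite c0 scale0r subr0 => /glspan_skewprim; apply.
have ba : b = a.
  have [f [f0 f1]] := separating_functional xs.
  have f10 : f 1 = 0 by rewrite -glval1 f0 ?glval_span.
  have Lz z : z \in glspan H -> lhit f z = 0.
    move/glspanP=> ->; rewrite linear_sum big1 // => g _ /=.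
    by rewrite linearZ /= lhit_grouplike ?glvalP // f0 ?glval_span // scale0r scaler0.
  have := Lz _ yc; rewrite linearB linearZ /= (lhit_skewprim _ sx) (lhit_skewprim _ sy).
  rewrite f10 f1 !scale0r !addr0 scale1r.
  have -> : f y = c.
    move/eqP: (f0 _ yc); rewrite linearB linearZ /= f1 subr_eq0 => /eqP ->.
    exact: mulr1.
  move/eqP; rewrite subr_eq0 => /eqP /(congr1 (fun v => c^-1 *: v)).
  by rewrite !scalerA mulVf // !scale1r => /glval_inj.
left; split=> //; exists c.
have [|d e] := glspan_skewprim (b := a) yc.
  rewrite addrC -scaleNr; apply: skewprim_lin => //; by rewrite -ba.
by exists d; rewrite -e addrC subrK.
Qed.

Lemma skewprim_coeff_inj (c c' d d' : k) :
  c *: x + d *: (glval a - 1) = c' *: x + d' *: (glval a - 1) ->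
  c = c' /\ (a = 1%g \/ d = d').
Proof.
move/eqP; rewrite -subr_eq0 opprD addrACA -!scalerBl => e.
have cc : c = c'.
  apply/eqP; rewrite -subr_eq0; apply: contraR xs => cc.
  move: e; rewrite addr_eq0 => /eqP /(congr1 (fun v => (c - c')^-1 *: v)).
  rewrite scalerA mulVf // scale1r => ->; rewrite memvZ // memvN memvZ //.
  by rewrite memvB ?glval_span // -glval1 glval_span.
split=> //; move: e; rewrite cc subrr scale0r add0r scaler_eq0 !subr_eq0.
case/orP=> /eqP; first by right.
by move=> a1; left; apply: glval_inj.
Qed.

Definition conj_datum (chi c : glgroup H -> k) : Prop :=
  forall g, glval g * x * glval g^-1%g = chi g *: x + c g *: (glval a - 1).

(** Conjugation by g maps (1,a)-skew-primitives to (1, g a g^-1)-skew-primitives and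
    preserves kG.  When a = 1 the coefficient c(g) is undetermined, and c = 0 is
    the choice that satisfies the cocycle identities. *)
Lemma conj_datum_ex : a \in 'Z([set: glgroup H])%g /\
  exists chi c, conj_datum chi c /\ (a = 1%g -> forall g, c g = 0).
Proof.
have cj g : (g * a * g^-1 = a)%g /\ exists p : k * k,
    glval g * x * glval g^-1%g = p.1 *: x + p.2 *: (glval a - 1) /\ (a = 1%g -> p.2 = 0).
  have sg : skewprim 1 (glval (g * a * g^-1)%g) (glval g * x * glval g^-1%g).
    have := skewprimMr (glvalP g^-1%g) (skewprimMl (glvalP g) sx).
    by rewrite mulr1 glmulrV.
  have [[ea [c [d e]]]|[d e]] := skewprim_classify sg; last first.
    case/negP: xs; rewrite -(glspanMl_eq g) -(glspanMr_eq g^-1%g) e memvZ // memvB //.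
      exact: glval_span.
    by rewrite -glval1 glval_span.
  split=> //; have [a1|na] := EM (a = 1%g); last by exists (c, d).
  by exists (c, 0); rewrite e a1 glval1 subrr !scaler0.
split.
  apply/centerP; split=> [|g _]; first by rewrite inE.
  by have [e _] := cj g; rewrite /commute -[in LHS]e -mulgA mulVg mulg1.
have [p hp] := fin_all_exists (fun g => proj2 (cj g)).
by exists (fun g => (p g).1), (fun g => (p g).2); split=> [g|a1 g]; have [] := hp g => // _ ->.
Qed.

Variables chi c : glgroup H -> k.
Hypotheses (aZ : a \in 'Z([set: glgroup H])%g) (cd : conj_datum chi c).
Hypothesis c_a1 : a = 1%g -> forall g, c g = 0.

Lemma glval_comm g : glval g * glval a = glval a * glval g.
Proof. by have /centerP[_ /(_ g (in_setT g))] := aZ; rewrite -!glvalM => ->. Qed.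

Lemma conj_sub1 g : glval g * (glval a - 1) * glval g^-1%g = glval a - 1.
Proof.
by rewrite mulrBr mulr1 mulrBl glval_comm -mulrA glmulrV mulr1.
Qed.

Lemma conj_datum_unique g (u v : k) :
  glval g * x * glval g^-1%g = u *: x + v *: (glval a - 1) ->
  chi g = u /\ (a = 1%g \/ c g = v).
Proof. by rewrite cd; apply: skewprim_coeff_inj. Qed.

Lemma conj_chi1 : chi 1%g = 1.
Proof.
have [|//] := @conj_datum_unique 1%g 1 0.
by rewrite invg1 glval1 mul1r mulr1 scale1r scale0r addr0.
Qed.

Lemma conj_chicM g h : chi (g * h)%g = chi g * chi h /\
  c (g * h)%g = chi h * c g + c h.
Proof.
have e : glval (g * h)%g * x * glval (g * h)^-1%g =
    (chi g * chi h) *: x + (chi h * c g + c h) *: (glval a - 1).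
  rewrite invMg !glvalM !mulrA -[glval g * _ * x]mulrA -[glval g * _ * glval h^-1%g]mulrA cd.
  rewrite mulrDr mulrDl -!scalerAr -!scalerAl cd conj_sub1 scalerDr !scalerA.
  by rewrite -addrA -scalerDl [chi h * chi g]mulrC.
have [-> [a1|//]] := conj_datum_unique e.
by rewrite !(c_a1 a1) mulr0 addr0.
Qed.

Lemma conj_commutes g : glval g * x = chi g *: (x * glval g) + c g *: ((glval a - 1) * glval g).
Proof.
have := congr1 (fun v => v * glval g) (cd g).
by rewrite -!mulrA glmulVr mulr1 mulrDl !scalerAl.
Qed.

Lemma mul_skewprim_glval g : x * glval g = 
  chi g^-1%g *: (glval g * x) + c g^-1%g *: (glval g * (glval a - 1)).
Proof.
have := congr1 (fun v => glval g * v) (cd g^-1%g).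
by rewrite invgK !mulrA glmulrV mul1r mulrDr !scalerAr.
Qed.

Lemma conjX g n : glval g * x ^+ n * glval g^-1%g = (glval g * x * glval g^-1%g) ^+ n.
Proof.
elim: n => [|n IHn]; first by rewrite !expr0 mulr1 glmulrV.
rewrite exprS [RHS]exprS -IHn !mulrA -[_ * glval g^-1%g * glval g]mulrA glmulVr.
by rewrite mulr1 -!mulrA.
Qed.

Lemma chi_neq0 g : chi g != 0.
Proof.
apply/eqP => g0; have [] := conj_chicM g g^-1%g.
by rewrite mulgV conj_chi1 g0 mul0r => /eqP; rewrite oner_eq0.
Qed.

(** S(v g) = g^-1 S(v) and S(v x) = - x a^-1 S(v) by [antipode_unique]; for the second,
    S(v_1 x) v_2 a + S(v_1) v_2 x = eps(v x) = 0. *)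
Lemma antipode_powers g j :
  antipode (glval g * x ^+ j) = (- (x * glval a^-1%g)) ^+ j * glval g^-1%g.
Proof.
have SM z u : (forall v, tlift (fun u w => antipode (u * z) * w) (comul v) =
    (counit v : k) *: u) -> forall v, antipode (v * z) = u * antipode v.
  move=> h v; pose F := (antipode \o amulr z)%VF.
  have FE w : F w = antipode (w * z) by rewrite comp_lfunE lfunE.
  rewrite -FE; apply: antipode_unique => w; rewrite -h.
  by rewrite /tlift; do 2!apply: eq_bigr => ? _; rewrite FE.
have pl z : forall w : H, linear (fun v => antipode (v * z) * w).
  by move=> w d u v; rewrite mulrDl linearD mulrDl -scalerAl linearZ /= scalerAl.
have pl' (S : 'End(H)) : forall w : H, linear (fun v => S v * w).
  by move=> w d u v; rewrite linearP mulrDl scalerAl.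
have pr (z : H) : linear (fun w => z * w).
  by move=> d u v; rewrite mulrDr scalerAr.
have main z w (s : tensor H H) :
    tlift (fun u w => antipode u * w) (s * tens z w) =
    tlift (fun u w => antipode (u * z) * w) s * w.
  elim/tens_ind: s => [u v|s t IHs IHt].
    by rewrite tensM !tlift_tens ?mulrA // => ?; apply: (pl' antipode).
  by rewrite mulrDl !linearD /= IHs IHt mulrDl.
have Sg h v : antipode (v * glval h) = glval h^-1%g * antipode v.
  apply: SM => {}v; have := antipodel (v * glval h).
  rewrite rmorphM /= (comul_grouplike (glvalP h)) main rmorphM /= (counit_grouplike (glvalP h)).
  move/(congr1 (fun v => v * glval h^-1%g)); rewrite -mulrA glmulrV !mulr1.
  by rewrite -scalerAl mul1r.
have Sx v : antipode (v * x) = - (x * glval a^-1%g) * antipode v.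
  apply: SM => {}v; have := antipodel (v * x).
  rewrite rmorphM /= sx mulrDr linearD /= !main.
  rewrite rmorphM /= (counit_skewprim (grouplike1 H) (glvalP a) sx) mulr0 scale0r.
  have -> : tlift (fun u w => antipode (u * 1) * w) (comul v) = (counit v : k)%:A.
    rewrite -antipodel /tlift; do 2!apply: eq_bigr => ? _; by rewrite mulr1.
  move/eqP; rewrite addr_eq0 => /eqP /(congr1 (fun v => v * glval a^-1%g)).
  by rewrite -mulrA glmulrV mulr1 => ->; rewrite mulNr -!scalerAl mul1r scalerN.
elim: j => [|j IHj].
  by rewrite !expr0 mul1r mulr1 -[glval g]mul1r Sg -glval1 -glvalV invg1 glval1 mulr1.
by rewrite exprSr mulrA Sx IHj exprS mulrA.
Qed.

(** The span of the g x^j with j < n contains 1 and is stable under left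
    multiplication by kG and by x, hence by H_1, which generates H. *)
Lemma powspan_full n : (1 < n)%N -> agenv (coradical1 H) = {: H}%VS ->
  x ^+ n \in powspan x n -> powspan x n = {: H}%VS.
Proof.
move=> n1 gen xn; apply/eqP; rewrite eqEsubv subvf -gen; apply: agenv_sub_modl.
  rewrite -memvE -[1]mulr1 -glval1 -[X in _ * X](expr0 x); apply: mem_powspan; lia.
have mulgF g v : v \in powspan x n -> glval g * v \in powspan x n.
  suff /subvP h : (powspan x n <= amull (glval g) @^-1: powspan x n)%VS.
    by move/h; rewrite -memv_preim lfunE.
  apply: powspan_ind => h j jn; rewrite -memv_preim lfunE /= mulrA -glvalM.
  exact: mem_powspan.
have mulxF v : v \in powspan x n -> x * v \in powspan x n.
  suff /subvP h : (powspan x n <= amull x @^-1: powspan x n)%VS.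
    by move/h; rewrite -memv_preim lfunE.
  apply: powspan_ind => h j jn; rewrite -memv_preim lfunE /= mulrA mul_skewprim_glval.
  rewrite mulrDl -!scalerAl memvD // memvZ //.
    rewrite -mulrA -exprS mulgF //; have [jn1|] := ltnP j.+1 n.
      by rewrite -[_ ^+ _]mul1r -glval1; apply: mem_powspan.
    by move=> nj; have -> : j.+1 = n by lia.
  rewrite mulrBr mulr1 mulrBl memvB //; last exact: mem_powspan.
  by rewrite -glvalM; apply: mem_powspan.
have mulsF z v : z \in glspan H -> v \in powspan x n -> z * v \in powspan x n.
  move/glspanP=> -> vF; rewrite mulr_suml memv_suml // => g _.
  by rewrite -scalerAl memvZ // mulgF.
apply/prodvP => u v uH1 vF.
suff /subvP h : (coradical1 H <= amulr v @^-1: powspan x n)%VS.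
  by have := h _ uH1; rewrite -memv_preim lfunE.
apply: coradical1_ind => // [g|g b y sy]; rewrite -memv_preim lfunE /=.
  exact: mulgF.
have [d yd] := skewprim_unique Hpt Hrk sx xs sy.
rewrite -mulrA mulgF // -(subrK (d *: x) y) mulrDl memvD //; first exact: mulsF.
by rewrite -scalerAl memvZ // mulxF.
Qed.

Lemma hopf_on_skewprim n : (1 < n)%N -> agenv (coradical1 H) = {: H}%VS ->
  c a = 0 -> (forall m, (0 < m < n)%N -> qint (chi a) m != 0) ->
  x ^+ n \in powspan x n ->
  hopf_on (G := glgroup H) a n (@glval k H) x.
Proof.
move=> n1 gen ca qm xn.
have ax : glval a * x = chi a *: (x * glval a).
  by rewrite conj_commutes ca scale0r addr0.
split.
- by split; [exact: glval1 | exact: glvalM].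
- rewrite /basis_of -/(powseq x n) (powers_free sx xs ax qm) andbT.
  by apply/eqP; apply: powspan_full.
- move=> g j _; rewrite rmorphM rmorphXn /= comul_grouplike ?glvalP //.
  by rewrite sx.
- move=> g j _; rewrite rmorphM rmorphXn /= counit_grouplike ?glvalP //.
  rewrite (counit_skewprim (grouplike1 H) (glvalP a) sx) mul1r expr0n.
  by case: j.
by move=> g j _; apply: antipode_powers.
Qed.

End SkewClassification.

(** * Auxiliary facts on the coradical, isomorphisms and the base field *)

(** If |G| = 0 in k, the sum s of all group-likes satisfies g s = s and s^2 = 0.  For a
    left ideal I of kG the line of s v, v in I, is again a left ideal; when I is
    simple, it is 0 or I, and in both cases s v = 0.  So s annihilates kG, contrary
    to s 1 = s <> 0. *)
Lemma semisimple_card (k : fieldType) (H : hopfAlgType k) :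
  semisimple (glspan H) -> #|[set: glgroup H]|%:R != 0 :> k.
Proof.
move=> ss; apply/eqP => G0.
pose s : H := \sum_g glval g.
have gs g : glval g * s = s.
  rewrite mulr_sumr [RHS](reindex_inj (mulgI g)); apply: eq_bigr => h _.
  by rewrite glvalM.
have s0 : s * s = 0.
  rewrite {1}/s mulr_suml (eq_bigr (fun=> s)) => [|g _]; last exact: gs.
  by rewrite sumr_const -cardsT -scaler_nat G0 scale0r.
have sS : s \in glspan H by apply: memv_suml => g _; apply: glval_span.
have /subvP sub : (glspan H <= lker (amull s))%VS.
  rewrite ss; apply: spanof_sub => v [I [[IB BI] I0 Imin] vI].
  rewrite memv_ker lfunE /=.
  have svI : s * v \in I by apply: (subvP BI); apply: memv_mul.
  have [] := Imin <[s * v]>%VS.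
  - split.
      by rewrite -memvE; apply: (subvP IB).
    apply/prodvP => z w zB /vlineP[d ->].
    rewrite (glspanP zB) mulr_suml memv_suml // => g _.
    by rewrite -scalerAl -scalerAr mulrA gs !memvZ ?memv_line.
  - by rewrite -memvE.
  - by move=> e; rewrite -memv0 -e memv_line.
  move=> sI; move: vI; rewrite -sI => /vlineP[d e].
  by rewrite e -scalerAr mulrA s0 mul0r scaler0.
have := sub 1; rewrite -glval1 glval_span => /(_ isT).
rewrite memv_ker lfunE /= glval1 mulr1 => /eqP /(congr1 (glcoef 1%g)).
rewrite linear0 linear_sum (bigD1 1%g) //= glcoefE eqxx big1 ?addr0 => [|g g1].
  by move/eqP; rewrite oner_eq0.
by rewrite glcoefE eq_sym (negPf g1).
Qed.

Lemma hopf_iso_refl (k : fieldType) (H : hopfAlgType k) : hopf_iso H H.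
Proof.
exists (AHom (id_is_ahom {:H}%VS)); split.
- by exists id => v; rewrite /= id_lfunE.
- move=> v /=; rewrite id_lfunE -[LHS]tmap_id.
  by rewrite /tmap /tlift; do 2!apply: eq_bigr => ? _; rewrite !id_lfunE.
- by move=> v; rewrite /= id_lfunE.
by move=> v; rewrite /= !id_lfunE.
Qed.

Lemma nth_root_closed (k : closedFieldType) n (c : k) : (0 < n)%N ->
  exists t, t ^+ n = c.
Proof.
move=> n0; have /closed_rootP[t] : size ('X^n - c%:P) != 1%N.
  by rewrite size_XnsubC // eqSS -lt0n.
by rewrite /root !hornerE subr_eq0 => /eqP; exists t.
Qed.

(** X^p - X has at most p roots, and the images of F_p are p of them. *)
Lemma pexp_id_primefield (k : fieldType) p (z : k) : p \in [pchar k] ->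
  z ^+ p = z -> exists u : 'F_p, z = (u : nat)%:R.
Proof.
move=> kp zp; have pp := pcharf_prime kp.
apply: contrapT => hN.
have natr_inj (m n : nat) : (m < p)%N -> (n < p)%N -> m%:R == n%:R :> k -> m = n.
  wlog mn : m n / (m <= n)%N.
    move=> w mp np e; case: (leqP m n) => [mn|/ltnW nm]; first exact: w.
    by apply/esym/w; rewrite // eq_sym.
  move=> mp np; rewrite eq_sym -subr_eq0 -natrB // -(dvdn_pcharf kp) => d.
  case: (posnP (n - m)) => [|/dvdn_leq/(_ d)]; lia.
pose rs : seq k := z :: [seq (nat_of_ord u)%:R | u <- enum 'F_p].
have sz : size ('X^p - 'X : {poly k}) = p.+1.
  by rewrite size_polyDl ?size_polyXn // size_polyN size_polyX ltnS prime_gt1.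
have nz : 'X^p - 'X != 0 :> {poly k} by rewrite -size_poly_eq0 sz.
have urs : uniq rs.
  rewrite /rs /=; apply/andP; split.
    by apply/mapP => -[u _ e]; apply: hN; exists u.
  rewrite map_inj_uniq ?enum_uniq // => u v /eqP e; apply: val_inj.
  by apply: natr_inj e; rewrite -[X in (_ < X)%N](Fp_cast pp) ltn_ord.
have rrs : all (root ('X^p - 'X)) rs.
  apply/allP => w; rewrite inE => /orP[/eqP->|/mapP[u _ ->]].
    by rewrite /root !hornerE zp subrr.
  by rewrite /root !hornerE -(pFrobenius_autE kp) pFrobenius_aut_nat subrr.
have := max_poly_roots nz rrs urs.
by rewrite sz /rs /= size_map -cardE card_Fp // ltnn.
Qed.

Lemma qint1E (k : fieldType) n : qint (1 : k) n = n%:R.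
Proof.
rewrite /qint (eq_bigr (fun=> 1)) => [|i _]; last by rewrite expr1n.
by rewrite sumr_const card_ord.
Qed.

Lemma qint_subX (k : fieldType) (q : k) n : (q - 1) * qint q n = q ^+ n - 1.
Proof. by rewrite subrX1. Qed.

(** * The two families *)

Section Classification.
Variables (k : closedFieldType) (p : nat) (kp : p \in [pchar k]) (H : hopfAlgType k).
Hypotheses (Hpt : pointed H) (Hrk : has_rank H 1).
Hypothesis Hgen : agenv (coradical1 H) = {: H}%VS.
Implicit Types (a g h : glgroup H) (x y : H).

Lemma pchar_falg : p \in [pchar H].
Proof.
by rewrite pchar_lalg.
Qed.

Lemma conj_chiX a x chi c : skewprim 1 (glval a) x -> x \notin glspan H ->
  a \in 'Z([set: glgroup H])%g -> conj_datum a x chi c ->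
  (a = 1%g -> forall g, c g = 0) -> forall g n, chi (g ^+ n)%g = chi g ^+ n.
Proof.
move=> sx xs aZ cd ca1 g; elim=> [|n IHn].
  by rewrite expg0 (conj_chi1 xs cd).
by rewrite expgS exprS (conj_chicM xs aZ cd ca1 g _).1 IHn.
Qed.

(** The translation y = x + l (a - 1) satisfies a y a^-1 = q y when l = c(a) / (q - 1).
    Comparing c(a g) with c(g a) then gives (q - 1) c(g) = 0 for all g. *)
Lemma rank_one_R a x chi c :
  skewprim 1 (glval a) x -> x \notin glspan H -> conj_datum a x chi c ->
  chi a != 1 ->
  exists R : datumR k p, dR_r R = 0%N /\
     exists2 K : hopfAlgType k, is_HR R K & hopf_iso H K.
Proof.
move=> sx xs cdx chia1; have q1 : chi a - 1 != 0 by rewrite subr_eq0.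
pose l := c a / (chi a - 1); pose y := l *: (glval a - 1) + x.
have a1s : glval a - 1 \in glspan H by rewrite memvB ?glval_span // -glval1 glval_span.
have sy : skewprim 1 (glval a) y.
  by apply: skewprim_lin => //; apply: skewprim_sub (grouplike1 H) (glvalP a).
have ys : y \notin glspan H by rewrite rpredDl // memvZ.
have [aZ [chi' [c' [cd ca1]]]] := conj_datum_ex Hpt Hrk sy ys.
have cja : glval a * y * glval a^-1%g = chi a *: y + 0 *: (glval a - 1).
  rewrite mulrDr mulrDl -scalerAr -scalerAl (conj_sub1 aZ) cdx scale0r addr0.
  rewrite addrCA -scalerDl [in RHS]/y [chi a *: (_ + _)]scalerDr scalerA [RHS]addrC; congr (_ + _ *: _).
  by rewrite /l; field.
have [chi'a ca] : chi' a = chi a /\ c' a = 0.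
  by have [-> [/ca1 e|->]] := conj_datum_unique ys cd cja.
pose chiM g h := (conj_chicM ys aZ cd ca1 g h).1.
pose cM g h := (conj_chicM ys aZ cd ca1 g h).2.
have c0 g : c' g = 0.
  have /centerP[_ /(_ g (in_setT g)) ag] := aZ.
  have := cM g a; rewrite -ag cM ca mulr0 add0r addr0 chi'a => /eqP.
  rewrite -subr_eq0 -{1}[c' g]mul1r -mulrBl mulf_eq0 -opprB oppr_eq0 (negPf q1).
  by move/eqP.
have [N NP _] : {N | N.-primitive_root (chi' a) & N %| #|[set: glgroup H]|}%N.
  apply: prim_order_exists; first exact: cardG_gt0.
  by rewrite -(conj_chiX sy ys aZ cd ca1) expg_cardG ?inE // (conj_chi1 ys cd).
have N0 := prim_order_gt0 NP.
have N1 : (1 < N)%N.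
  rewrite ltn_neqAle N0 andbT; apply/eqP => e; move: NP; rewrite -e => /prim_expr_order.
  by rewrite expr1 chi'a => /eqP; rewrite (negPf chia1).
have qchar m : (qint (chi' a) m == 0) = (N %| m)%N.
  rewrite (prim_order_dvd NP) -[in RHS]subr_eq0 -qint_subX mulf_eq0 chi'a.
  by rewrite (negPf q1).
have qN : qint (chi' a) N = 0 by apply/eqP; rewrite qchar.
have qm m : (0 < m < N)%N -> qint (chi' a) m != 0.
  by case/andP=> m0 mN; rewrite qchar gtnNdvd.
have ay : glval a * y = chi' a *: (y * glval a).
  by rewrite (conj_commutes cd) ca scale0r addr0.
have [d yN] : exists d : k, y ^+ N = d *: (glval (a ^+ N)%g - 1).
  have [[aN [e [d yN]]]|//] := skewprim_classify Hpt Hrk sy ys (skewprim_qchar sy ay N0 qN qm).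
  (* Conjugation by a fixes y^N, while it multiplies y by q. *)
  exists d; rewrite aN yN; suff -> : e = 0 by rewrite scale0r add0r.
  have := conjX y a N; rewrite (cd a) ca scale0r addr0 exprZn (prim_expr_order NP).
  rewrite scale1r yN mulrDr mulrDl -!scalerAr -!scalerAl (conj_sub1 aZ) cd ca.
  rewrite scale0r addr0 scalerA => /(skewprim_coeff_inj ys)[+ _].
  move/eqP; rewrite -subr_eq0 -{2}[e]mulr1 -mulrBr mulf_eq0 chi'a (negPf q1) orbF.
  by move/eqP.
(* If a^N = 1 the coefficient is arbitrary, and has to be taken as 0. *)
pose d' := if (a ^+ N == 1)%g then 0 else d.
have yN' : y ^+ N = d' *: (glval (a ^+ N)%g - 1).
  by rewrite yN /d'; case: eqP => // ->; rewrite glval1 subrr !scaler0.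
have yF : y ^+ N \in powspan y N.
  rewrite yN' memvZ // memvB //.
    rewrite -[glval _]mulr1 -[X in _ * X](expr0 y); exact: mem_powspan.
  rewrite -[1]mulr1 -[X in X * _]glval1 -[X in _ * X](expr0 y); exact: mem_powspan.
have am1 : (a ^+ (p ^ 0 * N) = 1)%g -> d' = 0.
  by rewrite expn0 mul1n /d' => ->; rewrite eqxx.
have al : forall i : 'I_0, (0 : k) != 0 ->
    (a ^+ (N * (p ^ 0 - p ^ i)) = 1)%g /\
    (forall g, chi' g ^+ (N * (p ^ 0 - p ^ i)) = 1) by case.
have am1P : d' != 0 -> forall g, chi' g ^+ (N * p ^ 0) = 1.
  rewrite expn0 muln1 => d0 g; have := conjX y g N.
  rewrite (cd g) c0 scale0r addr0 exprZn yN' -scalerAr -scalerAl.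
  have -> : glval g * (glval (a ^+ N)%g - 1) * glval g^-1%g = glval (a ^+ N)%g - 1.
    have /centerP[_ /(_ g (in_setT g)) ag] := aZ.
    rewrite mulrBr mulrBl mulr1 glmulrV -!glvalM.
    by rewrite (commuteX N (commute_sym ag)) -mulgA mulgV mulg1.
  move/eqP; rewrite scalerA -subr_eq0 -scalerBl scaler_eq0 subr_eq0 => /orP[].
    rewrite -{1}[d']mul1r => /eqP /(mulIf d0) /esym; exact.
  rewrite subr_eq0 => /eqP e; have aN : (a ^+ N = 1)%g by apply: glval_inj.
  by move: d0; rewrite /d' aN !eqxx.
pose R := @DatumR k p (glgroup H) chi' a 0 d' (fun=> 0) N
  (conj_chi1 ys cd) chiM aZ (eq_ind_r (fun z => z != 1) chia1 chi'a) NP am1 al am1P.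
exists R; split=> //; exists H; last exact: hopf_iso_refl.
have nE : dR_n R = N by rewrite /dR_n /= mul1n.
exists (@glval k H), y; rewrite nE; split.
- exact: (hopf_on_skewprim Hpt Hrk sy ys aZ cd N1 Hgen ca qm yF).
- by move=> g; rewrite (cd g) c0 scale0r addr0.
by rewrite big_ord0 addr0.
Qed.

(** The conditions on chi and c come from conjugating the relation for y^p by g:
    since y and a - 1 commute, Frobenius gives
    (chi(g) y + c(g)(a - 1))^p = chi(g)^p y^p + c(g)^p (a^p - 1). *)
Lemma rank_one_F_normal a y (alpham1 alpha0 : k) :
  skewprim 1 (glval a) y -> y \notin glspan H -> glval a * y = y * glval a ->
  y ^+ p = alpham1 *: (glval (a ^+ p)%g - 1) + alpha0 *: y ->
  (alpha0 = 0 /\ alpham1 = 0) \/ (alpha0 = 1 /\ (a ^+ p = a)%g) ->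
  exists F : datumF k p, exists2 K : hopfAlgType k, is_HF F K & hopf_iso H K.
Proof.
move=> sy ys ay yp alphaP; have pp := pcharf_prime kp; have Hp := pchar_falg.
have [aZ [chi [c [cd ca1]]]] := conj_datum_ex Hpt Hrk sy ys.
have [chia ca] : chi a = 1 /\ c a = 0.
  have e : glval a * y * glval a^-1%g = 1 *: y + 0 *: (glval a - 1).
    by rewrite ay -mulrA glmulrV mulr1 scale1r scale0r addr0.
  by have [-> [/ca1|->]] := conj_datum_unique ys cd e.
pose chiM g h := (conj_chicM ys aZ cd ca1 g h).1.
have cM g h : c (h * g)%g = chi g * c h + c g := (conj_chicM ys aZ cd ca1 h g).2.
have cjp g : glval g * y ^+ p * glval g^-1%g =
    chi g ^+ p *: y ^+ p + c g ^+ p *: (glval (a ^+ p)%g - 1).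
  rewrite conjX cd -(pFrobenius_autE Hp) pFrobenius_autD_comm; last first.
    rewrite /GRing.comm -!scalerAr -!scalerAl mulrBr mulrBl ay mulr1 mul1r.
    by rewrite !scalerA mulrC.
  rewrite !pFrobenius_autE !exprZn -(pFrobenius_autE Hp (_ - _)).
  by rewrite pFrobenius_autB_comm ?pFrobenius_aut1 ?pFrobenius_autE -?glvalX //; apply: commr1.
have al00 : alpha0 = 0 -> forall g,
    c g *: (grpelt k (a ^+ p)%g - grpelt k 1%g) = 0.
  case: alphaP => [[_ am0] a0 g|[-> _] /eqP]; last by rewrite oner_eq0.
  have := cjp g; rewrite yp am0 a0 !scale0r addr0 mulr0 mul0r scaler0 add0r.
  move/esym/eqP; rewrite scaler_eq0 expf_eq0 subr_eq0 => /orP[/andP[_ /eqP ->]|].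
    by rewrite scale0r.
  move=> /eqP e; have -> : (a ^+ p = 1)%g by apply: glval_inj.
  by rewrite subrr scaler0.
have al01 : alpha0 = 1 -> (a ^+ p = a)%g /\ forall g,
    (exists2 u : 'F_p, u != 0 & chi g = (u : nat)%:R) /\
    (alpham1 * (chi g - 1) + c g ^+ p - c g) *: (grpelt k a - grpelt k 1%g) = 0.
  case: alphaP => [[-> _] /esym/eqP|[_ ap] a1]; first by rewrite oner_eq0.
  split=> // g; have := cjp g; rewrite yp ap a1 scale1r mulrDr mulrDl.
  rewrite -scalerAr -scalerAl (conj_sub1 aZ) cd addrCA -scalerDl.
  rewrite [chi g ^+ p *: _]scalerDr scalerA [X in X + c g ^+ p *: _]addrC -addrA.
  rewrite -scalerDl => /(skewprim_coeff_inj ys)[/esym chip cp]; split.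
    have [u chiu] := pexp_id_primefield kp chip; exists u => //.
    by apply: contraNneq (chi_neq0 ys aZ cd ca1 g) => u0; rewrite chiu u0.
  case: cp => [a_1|cp]; first by rewrite a_1 subrr scaler0.
  rewrite [X in X *: _](_ : _ = 0) ?scale0r //.
  rewrite [LHS](_ : _ = (chi g * alpham1 + c g ^+ p) - (alpham1 + c g)); last by ring.
  by rewrite cp chip subrr.
have qm m : (0 < m < p)%N -> qint (chi a) m != 0.
  by case/andP=> m0 mp; rewrite chia qint1E -(dvdn_pcharf kp) gtnNdvd.
have p1 := prime_gt1 pp.
have yF : y ^+ p \in powspan y p.
  have pow1 g : glval g \in powspan y p.
    rewrite -[glval _]mulr1 -[X in _ * X](expr0 y); apply: mem_powspan; exact: ltnW.
  rewrite yp memvD // memvZ //; first by rewrite memvB // -glval1.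
  by have := @mem_powspan _ _ y 1%g 1 p p1; rewrite glval1 mul1r expr1.
have a01 : alpha0 = 0 \/ alpha0 = 1 by case: alphaP => -[-> _]; [left | right].
have am10 : alpha0 = 0 -> alpham1 = 0.
  by case: alphaP => [[_ ->]//|[-> _] /eqP]; rewrite oner_eq0.
pose F := @DatumF k p (glgroup H) chi c a alpham1 alpha0 (conj_chi1 ys cd) chiM aZ
  chia cM ca a01 am10 al00 al01.
exists F; exists H; last exact: hopf_iso_refl.
exists (@glval k H), y; split=> //.
exact: (hopf_on_skewprim Hpt Hrk sy ys aZ cd p1 Hgen ca qm yF).
Qed.

Hypothesis H0ss : semisimple (coradical H).

(** In the case x^p = d (a^p - 1), translate x by t (a - 1) with t^p = d; in the case
    x^p = e x + d (a - 1), rescale x by b with b^(p-1) = 1/e. *)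
Lemma rank_one_F a x chi c :
  skewprim 1 (glval a) x -> x \notin glspan H ->
  a \in 'Z([set: glgroup H])%g -> conj_datum a x chi c ->
  (a = 1%g -> forall g, c g = 0) -> chi a = 1 ->
  exists F : datumF k p, exists2 K : hopfAlgType k, is_HF F K & hopf_iso H K.
Proof.
move=> sx xs aZ cd ca1 chia; have pp := pcharf_prime kp; have Hp := pchar_falg.
have G0 : #|[set: glgroup H]|%:R != 0 :> k.
  by apply: semisimple_card; rewrite -coradicalE.
have cM g h := (conj_chicM xs aZ cd ca1 g h).2.
have c1 : c 1%g = 0.
  have := cM 1%g 1%g; rewrite mulg1 (conj_chi1 xs cd) mul1r => /eqP.
  by rewrite -subr_eq0 opprD addNKr oppr_eq0 => /eqP.
have ca : c a = 0.
  have cX m : c (a ^+ m)%g = m%:R * c a.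
    elim: m => [|m IHm]; first by rewrite expg0 c1 mul0r.
    by rewrite expgSr cM chia mul1r IHm mulrSr mulrDl mul1r.
  have := cX #|[set: glgroup H]|; rewrite expg_cardG ?inE // c1.
  by move/esym/eqP; rewrite mulf_eq0 (negPf G0) => /eqP.
have ax : glval a * x = x * glval a.
  by rewrite (conj_commutes cd) ca chia scale0r scale1r addr0.
have sxp : skewprim 1 (glval (a ^+ p)%g) (x ^+ p).
  apply: (skewprim_qchar (q := 1) sx); rewrite ?ax ?scale1r ?prime_gt0 //.
    by apply/eqP; rewrite qint1E -(dvdn_pcharf kp).
  by move=> m /andP[m0 mp]; rewrite qint1E -(dvdn_pcharf kp) gtnNdvd.
have shift (d : k) : x ^+ p = d *: (glval (a ^+ p)%g - 1) ->
    exists F : datumF k p, exists2 K : hopfAlgType k, is_HF F K & hopf_iso H K.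
  move=> xp; have [t td] := nth_root_closed d (prime_gt0 pp).
  pose y := (- t) *: (glval a - 1) + x.
  have a1s : glval a - 1 \in glspan H by rewrite memvB ?glval_span // -glval1 glval_span.
  apply: (@rank_one_F_normal a y 0 0).
  - by apply: skewprim_lin => //; apply: skewprim_sub (grouplike1 H) (glvalP a).
  - by rewrite rpredDl // memvZ.
  - by rewrite mulrDr mulrDl ax -scalerAr -scalerAl mulrBr mulrBl mulr1 mul1r.
  - rewrite !scale0r addr0 -(pFrobenius_autE Hp) pFrobenius_autD_comm; last first.
      by rewrite /GRing.comm -scalerAr -scalerAl mulrBr mulrBl ax mulr1 mul1r.
    rewrite !pFrobenius_autE exprZn xp -(pFrobenius_autE Hp (_ - _)).
    rewrite pFrobenius_autB_comm ?pFrobenius_aut1 ?pFrobenius_autE -?glvalX; last exact: commr1.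
    by rewrite -scalerDl -td -(pFrobenius_autE kp) pFrobenius_autN pFrobenius_autE addNr scale0r.
  by left.
have [[ap [e [d xp]]]|[d xp]] := skewprim_classify Hpt Hrk sx xs sxp; last exact: shift xp.
have [e0|e0] := eqVneq e 0.
  by apply: (shift d); rewrite xp e0 scale0r add0r ap.
have [b be] : exists b, b ^+ p.-1 = e^-1.
  by apply: nth_root_closed; have := prime_gt1 pp; lia.
have b0 : b != 0.
  apply: contra_eq_neq be => ->; rewrite expr0n.
  case: (p.-1 == 0)%N / eqP => [p1|_]; first by have := prime_gt1 pp; lia.
  by rewrite eq_sym invr_eq0.
apply: (@rank_one_F_normal a (b *: x) (b ^+ p * d) 1).
- by rewrite -[b *: x]addr0; apply: skewprim_lin => //; rewrite /skewprim linear0 tens0l linear0 addr0.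
- apply: contra xs => /(memvZ b^-1); by rewrite scalerA mulVf // scale1r.
- by rewrite -scalerAr ax scalerAl.
- rewrite exprZn xp ap scalerDr !scalerA mul1r addrC; congr (_ + _ *: _).
  by rewrite -(prednK (prime_gt0 pp)) exprS be -mulrA mulVf // mulr1.
by right.
Qed.
End Classification.

Theorem corollary3p12 (p : nat) (k : closedFieldType) (kp : p \in [pchar k])
    (H : hopfAlgType k) (Hpt : pointed H) (Hrk : has_rank H 1)
    (Hgen : agenv (coradical1 H) = {: H}%VS)
    (H0ss : semisimple (coradical H)) :
  (exists R : datumR k p, dR_r R = 0%N /\
     exists2 K : hopfAlgType k, is_HR R K & hopf_iso H K) \/
  (exists F : datumF k p,
     exists2 K : hopfAlgType k, is_HF F K & hopf_iso H K).
Proof.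
have [a [x [sx xs]]] := exists_skewprim Hpt Hrk.
have [aZ [chi [c [cd ca1]]]] := conj_datum_ex Hpt Hrk sx xs.
have [chia|chia] := eqVneq (chi a) 1.
  right; exact: (rank_one_F kp Hpt Hrk Hgen H0ss sx xs aZ cd ca1 chia).
left; exact: (rank_one_R p Hpt Hrk Hgen sx xs cd chia).
Qed.
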